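(* Let $p:\mathbb D\times[0,+\infty)\to\mathbb C$ be such that $p(\cdot,t)\in\mathcal P$ for each $t\ge 0$ and $p(z,\cdot)$ is measurable on $[0,+\infty)$ for each $z\in\mathbb D$. Suppose there are constants $0<\alpha<1$ and $C_1,C_2>0$ such that for all $z\in\mathbb D$ and $t\ge 0$, with $r=|z|$, $$\frac{|p(z,t)|}{\operatorname{Re} p(z,t)}\le\frac{C_1}{(1-r)^\alpha}\qquad\text{and}\qquad \operatorname{Re} p(z,t)\ge C_2(1-r)^\alpha .$$ Let $w(z,t)$ be the solution of the Loewner–Kufarev equation $$\frac{dw}{dt}=-w\,p(w,t),\qquad w(z,0)=z,\quad z\in\mathbb D .$$ Then for every $t\ge 0$ the inverse function of the map $w(\cdot,t):\mathbb D\to w(\mathbb D,t)$ extends continuously from $w(\mathbb D,t)$ to the closure $\overline{w(\mathbb D,t)}$.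
   Context: $\mathbb D=\{z\in\mathbb C:|z|<1\}$. $\mathcal P$ is the class of analytic functions $p:\mathbb D\to\mathbb C$ with $p(0)=1$ and $\operatorname{Re}p(z)>0$ for $z\in\mathbb D$. For $p$ as in the statement, for each $z\in\mathbb D$ the solution $t\mapsto w(z,t)$ is the (unique, locally absolutely continuous) function on $[0,+\infty)$ satisfying the equation for almost every $t$; for each $t$ the map $w(\cdot,t)$ is analytic and univalent in $\mathbb D$ with values in $\mathbb D$. *)

(* Defs.v *)
From HB Require Import structures.
From mathcomp Require Import all_boot all_order all_algebra.
From mathcomp Require Import complex.
From mathcomp Require Import all_classical all_reals all_analysis.

Set Implicit Arguments.
Unset Strict Implicit.
Unset Printing Implicit Defensive.

Import Order.TTheory GRing.Theory Num.Theory.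
Import numFieldNormedType.Exports.

Local Open Scope classical_set_scope.
Local Open Scope ring_scope.

(* The complex numbers over [R]; the regular-algebra tag [^o] is what gives
   [R[i]] its norm topology and its structure of normed module over itself. *)
Notation Cplx R := ((complex (Real.sort R))^o) (only parsing).

Notation ReC := complex.Re (only parsing).
Notation ImC := complex.Im (only parsing).

(* The modulus as an element of [R] (the generic norm [`|z|] lives in [R[i]]). *)
Notation cmod := ComplexField.Normc.normc (only parsing).

Definition unit_disc (R : realType) : set (Cplx R) := [set z | cmod z < 1].

(* [derivable] is taken over the scalar field [R[i]], so it is complex
   differentiability. *)
Definition analytic_on (R : realType) (D : set (Cplx R))
    (f : Cplx R -> Cplx R) : Prop :=
  forall z, D z -> derivable f z 1.

Definition class_P (R : realType) (f : Cplx R -> Cplx R) : Prop :=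
  [/\ analytic_on (@unit_disc R) f,
      f 0 = 1
    & forall z, unit_disc z -> 0 < ReC (f z)].

(* The domain carries the Caratheodory sigma-algebra of the outer measure
   induced by interval length, that is, the Lebesgue (not just Borel)
   measurable sets. *)
Definition lebesgue_measurable_fun (R : realType) (D : set R)
    (f : R -> R) : Prop :=
  @measurable_fun _ _ (caratheodory_type (wlength (@idfun R))^*%mu) R D f.

Definition lebesgue_measurable_cfun (R : realType) (D : set R)
    (f : R -> Cplx R) : Prop :=
  lebesgue_measurable_fun D (fun t => ReC (f t)) /\
  lebesgue_measurable_fun D (fun t => ImC (f t)).

Definition absolutely_continuous (R : realType) (a b : R)
    (f : R -> Cplx R) : Prop :=
  forall e : R, 0 < e -> exists2 d : R, 0 < d &
    forall (n : nat) (x y : 'I_n -> R),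
      (forall i, [/\ a <= x i, x i < y i & y i <= b]) ->
      trivIset [set: 'I_n] (fun i => `]x i, y i[%classic) ->
      \sum_(i < n) (y i - x i) < d ->
      \sum_(i < n) cmod (f (y i) - f (x i)) < e.

(* On [0, +oo[. *)
Definition locally_absolutely_continuous (R : realType)
    (f : R -> Cplx R) : Prop :=
  forall a b : R, 0 <= a -> a <= b -> absolutely_continuous a b f.

(* Derivative of a complex-valued function of a real variable. *)
Definition has_time_derivative (R : realType) (f : R -> Cplx R) (t : R)
    (v : Cplx R) : Prop :=
  ((real_complex R h)^-1 * (f (t + h) - f t) : Cplx R) @[h --> 0^'] --> v.

(* At [t = 0], the two-sided derivative involves values of [w z] at negative
   times, but [{0}] is a null set. *)
Definition loewner_kufarev_solution (R : realType)
    (p w : Cplx R -> R -> Cplx R) : Prop :=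
  forall z, unit_disc z ->
    [/\ w z 0 = z,
        forall t, 0 <= t -> unit_disc (w z t),
        locally_absolutely_continuous (w z)
      & {ae @lebesgue_measure R, forall t : R, 0 <= t ->
          has_time_derivative (w z) t (- w z t * p (w z t) t)}].

(* Main.v *)
(** Along a trajectory the speed |w||p| is at most C1 (1-|w|)^-alpha times the
    radial speed -d|w|/dt = |w| Re p, so a trajectory that has stayed in |w| >= 1/2
    up to time s has covered a length at most a constant times (1-|w(s)|^2)^(1-alpha).
    On a smaller disc, z p(z,t) is Lipschitz in z uniformly in t, because
    (1-|z|) |p'| <= 2 Re p for functions with positive real part; so trajectories
    that are close at time t stay close backwards in time, as long as they remain in
    the smaller disc.  Following two trajectories backwards until one of them comes
    near the unit circle, and then using the length bound for the remaining time,
    shows that the inverse of w(.,t) is uniformly continuous. *)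

Require Import Defs.
From HB Require Import structures.
From mathcomp Require Import all_boot all_order all_algebra.
From mathcomp Require Import complex.
From mathcomp Require Import all_classical all_reals all_analysis.
From mathcomp Require Import ring lra.

Set Implicit Arguments.
Unset Strict Implicit.
Unset Printing Implicit Defensive.

Import Order.TTheory GRing.Theory Num.Theory.
Import numFieldNormedType.Exports.

Local Open Scope classical_set_scope.
Local Open Scope ring_scope.

(** * Goursat's theorem on rectangles *)

(** Analyticity is given only as complex differentiability at each point; continuity of the
    derivative is not. The inequality behind the Lipschitz estimate is therefore built up from
    Goursat's subdivision: in logarithmic polar coordinates it shows that the mean of Re F over a
    circle does not depend on the radius, and an F made from f with a nonnegative weight turns this
    into the bound on f'. In time the equation holds only almost everywhere. Every estimate on
    trajectories is cast as the monotonicity of an absolutely continuous real function whose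
    derivative is >= 0 almost everywhere, so nothing is integrated in time. Squared moduli appear
    because |u| need not be differentiable where u vanishes. The Lipschitz constant blows up as the
    smaller disc fills the unit disc, so this disc must be fixed from the tolerance before the
    initial closeness is. The remaining shell is harmless because alpha < 1: the length bound has a
    positive exponent and tends to 0 at the circle. The radius 1/2 serves to compare |w| with
    |w|^2. *)

Section segment_integral.
Context {R : realType}.
Implicit Types (f g : R -> R) (a b m c e : R).
Notation mu := (@lebesgue_measure R).

Definition seg_int f a b : R := \int[mu]_(x in `[a, b]) f x.

Lemma seg_integrable f a b :
  (forall x, x \in `[a, b] -> {for x, continuous f}) ->
  mu.-integrable `[a, b] (EFin \o f).
Proof.
move=> fc; apply: continuous_compact_integrable; first exact: segment_compact.
apply: continuous_in_subspaceT => x; rewrite inE; exact: fc.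
Qed.

Lemma seg_int_split f a m b : a <= m -> m <= b ->
  (forall x, x \in `[a, b] -> {for x, continuous f}) ->
  seg_int f a b = seg_int f a m + seg_int f m b.
Proof.
move=> am mb fc; have fi := seg_integrable fc.
have := @Rintegral_itvB _ f (BLeft a) (BRight b) m fi.
rewrite !bnd_simp => /(_ am mb) /eqP; rewrite subr_eq => /eqP.
rewrite /seg_int => ->; rewrite addrC; congr +%R.
apply: Rintegral_itv_obnd_cbnd.
apply: (integrableS _ _ _ fi) => //.
by apply: subset_itvr; rewrite bnd_simp.
Qed.

Lemma seg_intB f g a b :
  (forall x, x \in `[a, b] -> {for x, continuous f}) ->
  (forall x, x \in `[a, b] -> {for x, continuous g}) ->
  seg_int (fun x => f x - g x) a b = seg_int f a b - seg_int g a b.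
Proof. by move=> /seg_integrable fi /seg_integrable gi; apply: RintegralB. Qed.

Lemma seg_int_cst c a b : a <= b -> seg_int (fun=> c) a b = c * (b - a).
Proof.
move=> ab; rewrite /seg_int Rintegral_cst//; set m := (X in fine X).
have -> : m = mu `[a, b] by []. rewrite lebesgue_measure_itv /= lte_fin.
by case: ltP => //= ba; have -> : b - a = 0 by lra.
Qed.

Lemma seg_int_near f c e a b : a <= b ->
  (forall x, x \in `[a, b] -> {for x, continuous f}) ->
  (forall x, x \in `[a, b] -> `|f x - c| <= e) ->
  `|seg_int f a b - c * (b - a)| <= e * (b - a).
Proof.
move=> ab fc fe; have cstc k x : x \in `[a, b] -> {for x, continuous (fun=> k : R)}.
  by move=> _; exact: cst_continuous.
rewrite ler_distl -mulrBl -mulrDl -!seg_int_cst//.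
apply/andP; split; apply: le_Rintegral => //;
  try exact: (seg_integrable (cstc _)); try exact: seg_integrable;
  by move=> x /= /fe; rewrite ler_distl => /andP[].
Qed.

End segment_integral.

(** * Circulation of a closed form around a rectangle *)

Section closed_forms.
Context {R : realType}.
Implicit Types (P Q : R -> R -> R) (x y w h e : R).

(** Fréchet differentiability at (x, y) with gradient (A, B), increments being measured in the l1
    norm. *)
Definition diff2 P x y A B := forall e, 0 < e -> exists2 d, 0 < d &
  forall x' y', `|x' - x| < d -> `|y' - y| < d ->
  `|P x' y' - P x y - A * (x' - x) - B * (y' - y)|
    <= e * (`|x' - x| + `|y' - y|).

Lemma diff2_swap P x y A B :
  diff2 P x y A B -> diff2 (fun y x => P x y) y x B A.
Proof.
move=> H e /H[d d0 {}H]; exists d => // x' y' xd yd.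
by have := H y' x' yd xd; rewrite addrAC (addrC `|y' - x|).
Qed.

Lemma diff2_continuousl P x y A B : diff2 P x y A B ->
  {for x, continuous (P ^~ y)}.
Proof.
move=> /(_ 1 ltr01)[d d0 H]; apply/(@cvgrPdist_le _ R^o) => e e0 /=.
have K0 : 0 < `|A| + 1 by rewrite ltr_pwDr.
near=> x'; rewrite distrC.
have xd : `|x' - x| < d.
  by rewrite distrC; near: x'; apply: cvgr_dist_lt => //; exact: cvg_id.
have xe : `|x' - x| < e / (`|A| + 1).
  rewrite distrC; near: x'; apply: cvgr_dist_lt; last by rewrite divr_gt0.
  exact: cvg_id.
have := H x' y xd; rewrite subrr normr0 mulr0 subr0 addr0 mul1r => /(_ d0) Hx.
rewrite -(subrK (A * (x' - x)) (P x' y - P x y)).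
rewrite (le_trans (ler_normD _ _))// normrM.
move: xe; rewrite ltr_pdivlMr// mulrDr mulr1 mulrC; lra.
Unshelve. all: by end_near. Qed.

Lemma diff2_continuousr P x y A B : diff2 P x y A B ->
  {for y, continuous (P x)}.
Proof. by move=> /diff2_swap/diff2_continuousl. Qed.

(* The circulation of P dx + Q dy around the boundary of a rectangle. *)
Definition circ P Q x0 x1 y0 y1 : R :=
  seg_int (fun x => P x y0 - P x y1) x0 x1 +
  seg_int (fun y => Q x1 y - Q x0 y) y0 y1.

(* The shared coefficient [B] says that the form P dx + Q dy is closed; the partial
   derivatives are not required to be continuous. *)
Definition closed_on P Q x0 x1 y0 y1 := forall x y,
  x \in `[x0, x1] -> y \in `[y0, y1] ->
  exists A B D, diff2 P x y A B /\ diff2 Q x y B D.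

Lemma closed_onS P Q x0 x1 y0 y1 x0' x1' y0' y1' :
  x0 <= x0' -> x1' <= x1 -> y0 <= y0' -> y1' <= y1 ->
  closed_on P Q x0 x1 y0 y1 -> closed_on P Q x0' x1' y0' y1'.
Proof.
move=> h1 h2 h3 h4 H x y; rewrite !in_itv /= => /andP[? ?] /andP[? ?].
by apply: H; rewrite in_itv /=; apply/andP; split; lra.
Qed.

Lemma closed_on_contPx P Q x0 x1 y0 y1 x y : closed_on P Q x0 x1 y0 y1 ->
  x \in `[x0, x1] -> y \in `[y0, y1] -> {for x, continuous (P ^~ y)}.
Proof. by move=> H xx yy; have [A [B [D [/diff2_continuousl]]]] := H x y xx yy. Qed.

Lemma closed_on_contQy P Q x0 x1 y0 y1 x y : closed_on P Q x0 x1 y0 y1 ->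
  x \in `[x0, x1] -> y \in `[y0, y1] -> {for y, continuous (Q x)}.
Proof. by move=> H xx yy; have [A [B [D [_ /diff2_continuousr]]]] := H x y xx yy. Qed.

Lemma continuousB_for (f g : R -> R) x : {for x, continuous f} ->
  {for x, continuous g} -> {for x, continuous (fun x => f x - g x)}.
Proof. by move=> fc gc; apply: (@continuousB _ R^o). Qed.

Lemma circ_splitx P Q x0 xm x1 y0 y1 : x0 <= xm -> xm <= x1 -> y0 <= y1 ->
  closed_on P Q x0 x1 y0 y1 ->
  circ P Q x0 x1 y0 y1 = circ P Q x0 xm y0 y1 + circ P Q xm x1 y0 y1.
Proof.
move=> xm0 xm1 yy H; rewrite /circ.
have in0 : x0 \in `[x0, x1] by rewrite in_itv /=; lra.
have inm : xm \in `[x0, x1] by rewrite in_itv /=; lra.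
have in1 : x1 \in `[x0, x1] by rewrite in_itv /=; lra.
have iy0 : y0 \in `[y0, y1] by rewrite in_itv /=; lra.
have iy1 : y1 \in `[y0, y1] by rewrite in_itv /=; lra.
have cQ x y : x \in `[x0, x1] -> y \in `[y0, y1] -> {for y, continuous (Q x)}.
  exact: closed_on_contQy H.
rewrite (seg_int_split xm0 xm1); last first.
  by move=> x xx; apply: continuousB_for; exact: (closed_on_contPx H).
rewrite !(seg_intB (f := Q _)); try (by move=> y yi; apply: cQ).
by ring.
Qed.

Lemma closed_on_swap P Q x0 x1 y0 y1 : closed_on P Q x0 x1 y0 y1 ->
  closed_on (fun y x => Q x y) (fun y x => P x y) y0 y1 x0 x1.
Proof.
move=> H y x yi xi; have [A [B [D [/diff2_swap p /diff2_swap q]]]] := H x y xi yi.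
by exists D, B, A.
Qed.

(** Exchanging the axes reverses the orientation of the boundary. This reduces cutting in the y
    direction to cutting in the x direction. *)
Lemma circ_swap P Q x0 x1 y0 y1 : x0 <= x1 -> y0 <= y1 ->
  closed_on P Q x0 x1 y0 y1 ->
  circ (fun y x => Q x y) (fun y x => P x y) y0 y1 x0 x1 = - circ P Q x0 x1 y0 y1.
Proof.
move=> xx yy H; rewrite /circ.
have in0 : x0 \in `[x0, x1] by rewrite in_itv /=; lra.
have in1 : x1 \in `[x0, x1] by rewrite in_itv /=; lra.
have iy0 : y0 \in `[y0, y1] by rewrite in_itv /=; lra.
have iy1 : y1 \in `[y0, y1] by rewrite in_itv /=; lra.
rewrite !seg_intB; try (by move=> z zi; apply: (closed_on_contQy H)).
  by ring.
all: by move=> z zi; apply: (closed_on_contPx H).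
Qed.

Lemma circ_splity P Q x0 x1 y0 ym y1 : x0 <= x1 -> y0 <= ym -> ym <= y1 ->
  closed_on P Q x0 x1 y0 y1 ->
  circ P Q x0 x1 y0 y1 = circ P Q x0 x1 y0 ym + circ P Q x0 x1 ym y1.
Proof.
move=> xx ym0 ym1 H.
have H1 : closed_on P Q x0 x1 y0 ym by exact: closed_onS H.
have H2 : closed_on P Q x0 x1 ym y1 by exact: closed_onS H.
have := circ_splitx ym0 ym1 xx (closed_on_swap H).
rewrite (circ_swap xx (le_trans ym0 ym1) H) (circ_swap xx ym0 H1).
by rewrite (circ_swap xx ym1 H2) -opprD => /oppr_inj.
Qed.

(* The affine parts of [P] and [Q] at (x, y) have zero circulation. *)
Lemma circ_small P Q x y A B D e : 0 < e ->
  diff2 P x y A B -> diff2 Q x y B D ->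
  exists2 d, 0 < d & forall x0 x1 y0 y1, x0 <= x <= x1 -> y0 <= y <= y1 ->
    x1 - x0 < d -> y1 - y0 < d -> closed_on P Q x0 x1 y0 y1 ->
    `|circ P Q x0 x1 y0 y1| <= e * (x1 - x0 + (y1 - y0)) ^+ 2.
Proof.
move=> e0 dP dQ; have e20 : 0 < e / 2 by lra.
have [d1 d10 {}dP] := dP _ e20; have [d2 d20 {}dQ] := dQ _ e20.
exists (Num.min d1 d2) => [|x0 x1 y0 y1 /andP[xx0 xx1] /andP[yy0 yy1]].
  by rewrite lt_min d10.
rewrite !lt_min => /andP[xd1 xd2] /andP[yd1 yd2] H.
have in0 : x0 \in `[x0, x1] by rewrite in_itv /=; lra.
have in1 : x1 \in `[x0, x1] by rewrite in_itv /=; lra.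
have iy0 : y0 \in `[y0, y1] by rewrite in_itv /=; lra.
have iy1 : y1 \in `[y0, y1] by rewrite in_itv /=; lra.
set s := x1 - x0 + (y1 - y0).
have dist_x z : z \in `[x0, x1] -> `|z - x| <= x1 - x0.
  by rewrite in_itv /= ler_norml => /andP[? ?]; apply/andP; split; lra.
have dist_y z : z \in `[y0, y1] -> `|z - y| <= y1 - y0.
  by rewrite in_itv /= ler_norml => /andP[? ?]; apply/andP; split; lra.
have nP u v : u \in `[x0, x1] -> v \in `[y0, y1] ->
    `|P u v - P x y - A * (u - x) - B * (v - y)| <= e / 2 * s.
  move=> /dist_x ux /dist_y vy; apply: (le_trans (dP _ _ _ _)); try lra.
  by rewrite ler_pM2l// lerD.
have nQ u v : u \in `[x0, x1] -> v \in `[y0, y1] ->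
    `|Q u v - Q x y - B * (u - x) - D * (v - y)| <= e / 2 * s.
  move=> /dist_x ux /dist_y vy; apply: (le_trans (dQ _ _ _ _)); try lra.
  by rewrite ler_pM2l// lerD.
(* The integrand is a difference of two values, each within [e / 2 * s] of its affine approximation.
   The terms in [A] cancel and leave the constant [B * (y0 - y1)]; the vertical sides give the
   opposite total, because [B] is shared. *)
have h1 : `|seg_int (fun x => P x y0 - P x y1) x0 x1
    - B * (y0 - y1) * (x1 - x0)| <= e * s * (x1 - x0).
  apply: seg_int_near => [|u ui|u ui]; first lra.
    by apply: continuousB_for; exact: (closed_on_contPx H).
  have := nP _ _ ui iy0; have := nP _ _ ui iy1.
  by rewrite !ler_norml => /andP[? ?] /andP[? ?]; apply/andP; split; lra.
have h2 : `|seg_int (fun y => Q x1 y - Q x0 y) y0 y1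
    - B * (x1 - x0) * (y1 - y0)| <= e * s * (y1 - y0).
  apply: seg_int_near => [|u ui|u ui]; first lra.
    by apply: continuousB_for; exact: (closed_on_contQy H).
  have := nQ _ _ in0 ui; have := nQ _ _ in1 ui.
  by rewrite !ler_norml => /andP[? ?] /andP[? ?]; apply/andP; split; lra.
have -> : e * s ^+ 2 = e * s * (x1 - x0) + e * s * (y1 - y0) by rewrite /s; ring.
rewrite /circ; move: h1 h2; move: (seg_int _ _ _) (seg_int _ _ _) => I1 I2.
have -> : B * (y0 - y1) * (x1 - x0) = - (B * (x1 - x0) * (y1 - y0)) by ring.
move: (B * _ * _) (e * s * _) (e * s * _) => k k1 k2.
by rewrite !ler_norml => /andP[? ?] /andP[? ?]; apply/andP; split; lra.
Qed.

End closed_forms.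

Section goursat.
Context {R : realType}.
Implicit Types (P Q : R -> R -> R) (x y w h e : R).

(** The circulation is the sum of those of the four quarters, so they cannot all be at most [k] in
    absolute value. Writing the sides as [w + w] and [h + h] avoids divisions. *)
Lemma circ_quarter P Q x y w h k : 0 <= w -> 0 <= h ->
  closed_on P Q x (x + (w + w)) y (y + (h + h)) ->
  4 * k < `|circ P Q x (x + (w + w)) y (y + (h + h))| ->
  exists x' y', [/\ x <= x', x' <= x + w, y <= y', y' <= y + h &
    k < `|circ P Q x' (x' + w) y' (y' + h)|].
Proof.
move=> w0 h0 H; rewrite (@circ_splitx _ P Q x (x + w)) ?lerDl ?lerD2l ?addr_ge0//.
have yh : y <= y + h by rewrite lerDl.
have yhh : y + h <= y + (h + h) by rewrite lerD2l lerDl.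
rewrite (@circ_splity _ P Q x (x + w) y (y + h)) ?lerDl//; last first.
  by apply: closed_onS H => //; rewrite lerD2l lerDl.
rewrite (@circ_splity _ P Q (x + w) (x + (w + w)) y (y + h)) ?lerD2l ?lerDl//; last first.
  by apply: closed_onS H => //; rewrite lerDl.
have big4 (c1 c2 c3 c4 : R) : 4 * k < `|c1 + c2 + (c3 + c4)| ->
    [\/ k < `|c1|, k < `|c2|, k < `|c3| | k < `|c4|].
  move=> lt4; have ls : 4 * k < `|c1| + `|c2| + (`|c3| + `|c4|).
    by apply: (lt_le_trans lt4); rewrite (le_trans (ler_normD _ _))// lerD// ler_normD.
  case: (ltP k `|c1|) => h1; first exact: Or41.
  case: (ltP k `|c2|) => h2; first exact: Or42.
  case: (ltP k `|c3|) => h3; first exact: Or43.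
  case: (ltP k `|c4|) => h4; first exact: Or44.
  by move: ls h1 h2 h3 h4; clear; lra.
have xw : x <= x + w by rewrite lerDl.
rewrite !(addrA _ w) !(addrA _ h) => /big4[] b4.
- by exists x, y.
- by exists x, (y + h).
- by exists (x + w), y.
- by exists (x + w), (y + h).
by rewrite lerDl.
Qed.

(** Every left end lies below every right end, so the supremum of the left ends works. *)
Lemma nested_segments (x l : nat -> R) :
  (forall n, x n <= x n.+1) -> (forall n, 0 <= l n) ->
  (forall n, x n.+1 + l n.+1 <= x n + l n) ->
  exists X, forall n, x n <= X <= x n + l n.
Proof.
move=> xi l0 xd.
have mono n k : x n <= x (n + k)%N.
  elim: k => [|k IH]; first by rewrite addn0.
  by rewrite addnS (le_trans IH).
have anti n k : x (n + k)%N + l (n + k)%N <= x n + l n.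
  elim: k => [|k IH]; first by rewrite addn0.
  by rewrite addnS (le_trans _ IH).
have ub n m : x m <= x n + l n.
  have [mn|/ltnW nm] := leqP m n.
    by have := mono m (n - m)%N; rewrite subnKC// => /le_trans; apply; rewrite lerDl.
  by have := anti n (m - n)%N; rewrite subnKC//; apply: le_trans; rewrite lerDl.
exists (sup (range x)) => n; apply/andP; split.
  apply: ub_le_sup; last by exists n.
  by exists (x 0%N + l 0%N) => _ [m _ <-]; exact: ub.
by apply: ge_sup; [exists (x 0%N), 0%N | move=> _ [m _ <-]; exact: ub].
Qed.

(** Halving the sides divides the bound [e * (W n + V n) ^+ 2] by 4, exactly the loss allowed when
    passing to a quarter. A nonzero circulation therefore stays above this bound at every scale,
    against [circ_small] at the common point of the nested rectangles. *)
Lemma goursat P Q x0 x1 y0 y1 : x0 <= x1 -> y0 <= y1 ->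
  closed_on P Q x0 x1 y0 y1 -> circ P Q x0 x1 y0 y1 = 0.
Proof.
move=> xx yy H; apply/eqP; rewrite -normr_le0 leNgt; apply/negP => pos.
have halves (w : R) : 0 <= w -> exists2 W : nat -> R, W 0%N = w &
    [/\ forall n, 0 <= W n, forall n, W n = W n.+1 + W n.+1 &
     forall n, W n = w * (1 / 2 ^+ n)].
  move=> w0; exists (fun n => w / 2 ^+ n); rewrite ?expr0 ?divr1//; split => n.
  - by rewrite divr_ge0// exprn_ge0.
  - by rewrite exprS; field; exact: expf_neq0.
  - by rewrite div1r.
have w0 : 0 <= x1 - x0 by rewrite subr_ge0.
have h0 : 0 <= y1 - y0 by rewrite subr_ge0.
have [W Ww [W0 WS WE]] := halves _ w0.
have [V Vh [V0 VS VE]] := halves _ h0; clear halves.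
have s0 : 0 < (x1 - x0 + (y1 - y0)) ^+ 2 + 1 by rewrite ltr_wpDl// sqr_ge0.
(* The summand 1 makes the inequality [He] strict and covers a rectangle reduced to a point. *)
pose e := `|circ P Q x0 x1 y0 y1| / ((x1 - x0 + (y1 - y0)) ^+ 2 + 1).
have e0 : 0 < e by rewrite divr_gt0.
have He : e * (x1 - x0 + (y1 - y0)) ^+ 2 < `|circ P Q x0 x1 y0 y1|.
  by rewrite mulrAC ltr_pdivrMr// ltr_pM2l// ltrDl.
clearbody e.
(* Some quarter of a rectangle with a large circulation again has a large one. *)
pose good n (u : R * R) := [/\ x0 <= u.1, u.1 + W n <= x1, y0 <= u.2,
  u.2 + V n <= y1 & e * (W n + V n) ^+ 2 <
    `|circ P Q u.1 (u.1 + W n) u.2 (u.2 + V n)|].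
have step n u : exists u', good n u ->
    [/\ good n.+1 u', u.1 <= u'.1, u'.1 + W n.+1 <= u.1 + W n,
        u.2 <= u'.2 & u'.2 + V n.+1 <= u.2 + V n].
  have [[g1 g2 g3 g4]|ng] := pselect (good n u); last by exists u.
  have cl : closed_on P Q u.1 (u.1 + W n) u.2 (u.2 + V n) by exact: closed_onS H.
  move: g2 g4 cl; rewrite (WS n) (VS n) => g2 g4 cl.
  have -> : e * (W n.+1 + W n.+1 + (V n.+1 + V n.+1)) ^+ 2 =
    4 * (e * (W n.+1 + V n.+1) ^+ 2) by ring.
  move=> /(circ_quarter (W0 _) (V0 _) cl)[x' [y' [b1 b2 b3 b4 b5]]].
  exists (x', y') => _; rewrite /= !addrA.
  rewrite !lerD2r b1 b2 b3 b4; split => //; split => //=.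
  - exact: le_trans b1.
  - by apply: le_trans g2; rewrite addrA lerD2r.
  - exact: le_trans b3.
  - by apply: le_trans g4; rewrite addrA lerD2r.
have [f fP] := choice (fun nu : nat * (R * R) => step nu.1 nu.2).
pose u := fix u n := if n is n'.+1 then f (n', u n') else (x0, y0).
have gu n : good n (u n).
  elim: n => [|n /(fP (n, _))[]//].
  by rewrite /good Ww Vh /= !subrKC.
have uS n := fP (n, u n) (gu n).
have [X HX] : exists X, forall n, (u n).1 <= X <= (u n).1 + W n.
  by apply: nested_segments => // n; have [] := uS n.
have [Y HY] : exists Y, forall n, (u n).2 <= Y <= (u n).2 + V n.
  by apply: nested_segments => // n; have [] := uS n.
have [A [B [D [dP dQ]]]] : exists A B D, diff2 P X Y A B /\ diff2 Q X Y B D.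
  apply: H; rewrite in_itv /=.
    by have := HX 0%N; rewrite Ww /= subrKC.
  by have := HY 0%N; rewrite Vh /= subrKC.
have [d d0 Hd] := circ_small e0 dP dQ.
have [n nd] : exists n, (x1 - x0 + (y1 - y0) + 1) * (1 / 2 ^+ n) < d.
  have K0 : 0 < x1 - x0 + (y1 - y0) + 1 by rewrite ltr_wpDl// addr_ge0.
  have dK0 : 0 < d / (x1 - x0 + (y1 - y0) + 1) by rewrite divr_gt0.
  have [n _ /(_ n (leqnn n))] := near_infty_natSinv_expn_lt (PosNum dK0).
  by rewrite /= ltr_pdivlMr// mulrC => nd; exists n.
have [g1 g2 g3 g4] := gu n; apply/negP; rewrite -leNgt.
have := Hd (u n).1 ((u n).1 + W n) (u n).2 ((u n).2 + V n) (HX n) (HY n).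
rewrite !(addrAC _ _ (- _)) !subrr !add0r; apply.
- apply: le_lt_trans nd; rewrite WE ler_wpM2r ?divr_ge0 ?exprn_ge0//.
  by rewrite -addrA lerDl addr_ge0.
- apply: le_lt_trans nd; rewrite VE ler_wpM2r ?divr_ge0 ?exprn_ge0//.
  by rewrite -addrA addrCA lerDl addr_ge0.
- exact: closed_onS H.
Qed.

End goursat.

(** * Functions with positive real part *)

Section complex_facts.
Context {R : realType}.
Implicit Types (z a h d : Cplx R) (e x y : R).

Lemma cmodE z : cmod z = Num.sqrt (ReC z ^+ 2 + ImC z ^+ 2).
Proof. by case: z. Qed.

Lemma cmod_ge0 z : 0 <= cmod z.
Proof. by rewrite cmodE sqrtr_ge0. Qed.

Lemma sqr_cmod z : cmod z ^+ 2 = ReC z ^+ 2 + ImC z ^+ 2.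
Proof. by rewrite cmodE sqr_sqrtr// addr_ge0 ?sqr_ge0. Qed.

Lemma ler_sqr_cmod z e : 0 <= e -> (cmod z <= e) = (ReC z ^+ 2 + ImC z ^+ 2 <= e ^+ 2).
Proof. by move=> e0; rewrite -sqr_cmod ler_sqr// nnegrE ?cmod_ge0. Qed.

Lemma normr_Re z : `|ReC z| <= cmod z.
Proof. by rewrite cmodE -sqrtr_sqr; apply: ler_wsqrtr; rewrite lerDl sqr_ge0. Qed.

Lemma normr_Im z : `|ImC z| <= cmod z.
Proof. by rewrite cmodE -sqrtr_sqr; apply: ler_wsqrtr; rewrite lerDr sqr_ge0. Qed.

Lemma cmod_leD z : cmod z <= `|ReC z| + `|ImC z|.
Proof.
rewrite ler_sqr_cmod ?addr_ge0// sqrrD !real_normK ?num_real//.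
by rewrite lerD2r lerDl mulrn_wge0 ?mulr_ge0.
Qed.

Lemma cmodB z z' : cmod (z - z') = cmod (z' - z).
Proof. by rewrite -opprB normcN. Qed.

Lemma cmodD z z' : cmod (z + z') <= cmod z + cmod z'.
Proof. exact: le_normcD. Qed.

Lemma cmodM z z' : cmod (z * z') = cmod z * cmod z'.
Proof. exact: Normc.normcM. Qed.

Lemma cmod0 : cmod (0 : Cplx R) = 0. Proof. exact: Normc.normc0. Qed.

Lemma cmod_eq0 z : (cmod z == 0) = (z == 0).
Proof.
by apply/eqP/eqP => [/Normc.eq0_normc//|->]; rewrite cmod0.
Qed.

Lemma cmod_gt0 z : (0 < cmod z) = (z != 0).
Proof. by rewrite lt0r cmod_eq0 cmod_ge0 andbT. Qed.

Lemma cmod_real x : cmod (x +i* 0)%C = `|x|.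
Proof. by rewrite cmodE /= expr0n addr0 sqrtr_sqr. Qed.

Lemma normE z : `|z| = (cmod z)%:C%C.
Proof. by case: z. Qed.

Lemma Re_add z z' : ReC (z + z') = ReC z + ReC z'.
Proof. by case: z; case: z'. Qed.
Lemma Im_add z z' : ImC (z + z') = ImC z + ImC z'.
Proof. by case: z; case: z'. Qed.
Lemma Re_opp z : ReC (- z) = - ReC z.
Proof. by case: z. Qed.
Lemma Im_opp z : ImC (- z) = - ImC z.
Proof. by case: z. Qed.
Lemma Re_mul z z' : ReC (z * z') = ReC z * ReC z' - ImC z * ImC z'.
Proof. by case: z; case: z'. Qed.
Lemma Im_mul z z' : ImC (z * z') = ReC z * ImC z' + ImC z * ReC z'.
Proof. by case: z => a b; case: z' => c d. Qed.
Definition ReImE := (Re_add, Im_add, Re_opp, Im_opp, Re_mul, Im_mul).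

Lemma complex_ext z z' : ReC z = ReC z' -> ImC z = ImC z' -> z = z'.
Proof. by case: z => a b; case: z' => c d /= -> ->. Qed.

(** The norm of [R[i]] takes values in [R[i]], so the radius of a ball is a complex number, positive
    only if its imaginary part is 0. Its real part is the radius sought. *)
Lemma nearE_cmod z (P : set (Cplx R)) :
  nbhs z P <-> exists2 e, 0 < e & forall z', cmod (z' - z) < e -> P z'.
Proof.
split=> [/nbhs_ballP[e e0 H]|[e e0 H]].
  move: e0 H; rewrite /= ltcE => /andP[/eqP ime e0] H; exists (ReC e) => // z' zz'.
  by apply: H; rewrite -ball_normE /ball_ /= distrC normE ltcE /= ime eqxx.
apply/nbhs_ballP; exists (e%:C)%C; first by rewrite /= ltcR.
by move=> z'; rewrite -ball_normE /ball_ /= distrC normE ltcR; exact: H.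
Qed.

(** The derivative without a quotient: [h = 0] is allowed, so an increment coming from real
    parameters can be substituted without a case analysis. *)
Definition cder (F : Cplx R -> Cplx R) z d := forall e, 0 < e ->
  exists2 dl, 0 < dl & forall h, cmod h < dl ->
    cmod (F (z + h) - F z - d * h) <= e * cmod h.

Lemma derivable_cder F z : derivable F z 1 -> cder F z ('D_1 F z).
Proof.
move=> /derivableP [+ _]; rewrite /derivable => Fd e e0.
have {Fd} : (fun h : Cplx R => h^-1 *: (F (h *: (1 : Cplx R) + z) - F z)) @ 0^'
  --> 'D_1 F z by exact: Fd.
move=> /cvgrPdist_lt /(_ (e%:C)%C); rewrite ltcR => /(_ e0).
rewrite /nbhs /= /within /= => /nearE_cmod[dl dl0 H]; exists dl => // h hd.
have [->|h0] := eqVneq h 0.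
  by rewrite addr0 subrr mulr0 subr0 !cmod0 mulr0.
have := H h; rewrite subr0 => /(_ hd h0).
rewrite /= normE ltcR => /ltW; rewrite cmodB => Hh.
have -> : F (z + h) - F z - 'D_1 F z * h =
  (h^-1 *: (F (h *: (1 : Cplx R) + z) - F z) - 'D_1 F z) * h.
  rewrite mulrBl /GRing.scale /= mulr1 (addrC h) mulrAC mulVf// mul1r //.
by rewrite cmodM ler_wpM2r ?cmod_ge0.
Qed.

End complex_facts.

(** * Differentiation in polar coordinates *)

Section circle.
Context {R : realType}.
Implicit Types (z a d : Cplx R) (e x y : R) (F : Cplx R -> Cplx R).

Lemma is_derive_approx (f : R -> R) x (df : R) : is_derive x 1 f df ->
  forall e, 0 < e -> exists2 d, 0 < d & forall x', `|x' - x| < d ->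
    `|f x' - f x - df * (x' - x)| <= e * `|x' - x|.
Proof.
move=> [fd <-] e e0; move: (fd) => /derivableP[+ _]; rewrite /derivable => Fd.
have {Fd} : (fun h : R => h^-1 *: (f (h *: (1 : R) + x) - f x)) @ 0^'
  --> 'D_1 f x by exact: Fd.
move=> /(@cvgrPdist_lt _ R^o) /(_ e e0) [/= d d0 H]; exists d => // x' xx'.
have [->|x'x] := eqVneq x' x; first by rewrite !subrr mulr0 subr0 normr0 mulr0.
have h0 : x' - x != 0 by rewrite subr_eq0.
have := H (x' - x); rewrite /= sub0r normrN => /(_ xx' h0) /ltW.
rewrite /GRing.scale /= mulr1 subrK distrC => Hh.
rewrite (_ : f x' - f x - _ = ((x' - x)^-1 * (f x' - f x) - 'D_1 f x) * (x' - x)).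
  by rewrite normrM ler_wpM2r.
by rewrite mulrBl mulrAC mulVf// mul1r.
Qed.

(** Meant for the coordinates [expR x * cos y] and [expR x * sin y], and for their variants with [r]
    in place of [expR x]. *)
Lemma diff2_mul (u v : R -> R) x y (du dv : R) :
  is_derive x 1 u du -> is_derive y 1 v dv ->
  diff2 (fun x y => u x * v y) x y (du * v y) (u x * dv).
Proof.
move=> /is_derive_approx Hu /is_derive_approx Hv e e0.
pose K := `|u x| + `|du| + `|v y| + `|dv| + 1.
have K1 : 1 <= K by rewrite /K lerDr !addr_ge0.
have K0 : 0 < K by apply: lt_le_trans K1.
have eK : 0 < Num.min 1 (e / (4 * K)) by rewrite lt_min ltr01 divr_gt0// mulr_gt0.
have [d1 d10 {}Hu] := Hu _ eK; have [d2 d20 {}Hv] := Hv _ eK.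
(* The last bound is for the cross term, at most [K * |X|] times [K * |Y|]: it has second order, and
   smallness of |X| alone controls it. *)
exists (Num.min (Num.min d1 d2) (e / (4 * K * K))).
  by rewrite !lt_min d10 d20 divr_gt0// !mulr_gt0.
move=> x' y'; rewrite !lt_min => /andP[/andP[/Hu Hx _] xK] /andP[/andP[_ /Hv Hy] _].
set X := x' - x in Hx xK *; set Y := y' - y in Hy *.
set U := u x' - u x - du * X in Hx; set V := v y' - v y - dv * Y in Hy.
have mle (k : R) : Num.min 1 (e / (4 * K)) * `|k| <= `|k| /\
   K * (Num.min 1 (e / (4 * K)) * `|k|) <= e / 4 * `|k|.
  split; first by rewrite ler_piMl// ge_min lexx.
  rewrite mulrA ler_wpM2r//.
  have : Num.min 1 (e / (4 * K)) <= e / (4 * K) by rewrite ge_min lexx orbT.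
  rewrite -(ler_pM2l K0) => /le_trans; apply.
  by rewrite le_eqVlt; apply/orP; left; apply/eqP; field; rewrite gt_eqF.
have [Ux Ux'] := mle X; have [Vy Vy'] := mle Y.
have -> : u x' * v y' - u x * v y - du * v y * X - u x * dv * Y =
   U * v y + u x * V + (U + du * X) * (V + dv * Y).
  by rewrite /U /V; ring.
have n1 : `|U * v y| <= e / 4 * `|X|.
  apply: le_trans Ux'; rewrite normrM mulrC ler_pM// /K.
  by have := normr_ge0 (u x); have := normr_ge0 du; have := normr_ge0 dv; lra.
have n2 : `|u x * V| <= e / 4 * `|Y|.
  apply: le_trans Vy'; rewrite normrM ler_pM// /K.
  by have := normr_ge0 (v y); have := normr_ge0 du; have := normr_ge0 dv; lra.
have n3 : `|(U + du * X) * (V + dv * Y)| <= e / 4 * `|Y|.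
  have -> : e / 4 * `|Y| = (K * (e / (4 * K * K))) * (K * `|Y|).
    by field; rewrite gt_eqF.
  have nX : `|U + du * X| <= K * `|X|.
    have := ler_normD U (du * X); rewrite normrM.
    have : (1 + `|du|) * `|X| <= K * `|X|.
      rewrite ler_wpM2r// /K.
      by have := normr_ge0 (u x); have := normr_ge0 (v y); have := normr_ge0 dv; lra.
    by move: (le_trans Hx Ux); rewrite mulrDl mul1r; lra.
  have nY : `|V + dv * Y| <= K * `|Y|.
    have := ler_normD V (dv * Y); rewrite normrM.
    have : (1 + `|dv|) * `|Y| <= K * `|Y|.
      rewrite ler_wpM2r// /K.
      by have := normr_ge0 (u x); have := normr_ge0 (v y); have := normr_ge0 du; lra.
    by move: (le_trans Hy Vy); rewrite mulrDl mul1r; lra.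
  rewrite normrM ler_pM//; apply: le_trans nX _.
  by rewrite ler_pM2l// ltW.
apply: le_trans (ler_normD _ _) _; apply: le_trans (lerD (ler_normD _ _) (lexx _)) _.
have := normr_ge0 X; have := normr_ge0 Y; move: n1 n2 n3.
move: `|U * _| `|u x * _| `|_ * (V + _)| `|X| `|Y| => a b c X' Y' n1 n2 n3 X0 Y0.
have := mulr_ge0 (ltW e0) X0; have := mulr_ge0 (ltW e0) Y0; lra.
Qed.

Lemma diff2_cst_add (k : R) (P : R -> R -> R) x y A B : diff2 P x y A B ->
  diff2 (fun x y => k + P x y) x y A B.
Proof.
move=> H e /H[d d0 {}H]; exists d => // x' y' /H {}H /H.
by rewrite opprD addrACA subrr add0r.
Qed.

(** The chain rule. The factor [u] treats both components at once: [u = 1] gives the real part of F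
    and [u = - i] its imaginary part. *)
Lemma diff2_cder F (g1 g2 : R -> R -> R) x y A1 B1 A2 B2 d (u : Cplx R) :
  cder F (g1 x y +i* g2 x y)%C d ->
  diff2 g1 x y A1 B1 -> diff2 g2 x y A2 B2 ->
  diff2 (fun x y => ReC (u * F (g1 x y +i* g2 x y)%C)) x y
    (ReC (u * d * (A1 +i* A2)%C)) (ReC (u * d * (B1 +i* B2)%C)).
Proof.
move=> HF H1 H2 e e0.
pose K := `|A1| + `|A2| + `|B1| + `|B2| + 1.
pose M := cmod u * (cmod d + 1) + 1.
have K1 : 1 <= K by rewrite /K lerDr !addr_ge0.
have M1 : 1 <= M by rewrite /M lerDr mulr_ge0 ?addr_ge0 ?cmod_ge0.
have K0 : 0 < K by apply: lt_le_trans K1.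
have M0 : 0 < M by apply: lt_le_trans M1.
(* The increment satisfies |h| <= 3 K S, and the final error is at most [M * (3 * K * e' * S)],
   which is half of the allowance. The radius [dl / (6 * K)] below keeps |h| < [dl], as S is a sum
   of two distances. *)
pose e' := Num.min 1 (e / (6 * M * K)).
have e'0 : 0 < e' by rewrite lt_min ltr01 divr_gt0// !mulr_gt0.
have e'1 : e' <= 1 by rewrite ge_min lexx.
have e'M : e' * (6 * M * K) <= e.
  by rewrite -ler_pdivlMr ?mulr_gt0// ge_min lexx orbT.
have [dl dl0 {}HF] := HF _ e'0.
have [d1 d10 {}H1] := H1 _ e'0; have [d2 d20 {}H2] := H2 _ e'0.
exists (Num.min (Num.min d1 d2) (dl / (6 * K))).
  by rewrite !lt_min d10 d20 divr_gt0// mulr_gt0.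
move=> x' y'; rewrite !lt_min => /andP[/andP[xd1 xd2] xK] /andP[/andP[yd1 yd2] yK].
have := H1 _ _ xd1 yd1; have := H2 _ _ xd2 yd2.
set X := x' - x in xK *; set Y := y' - y in yK *; set S := `|X| + `|Y|.
have S0 : 0 <= S by rewrite addr_ge0.
have XS : `|X| <= S by rewrite lerDl.
have YS : `|Y| <= S by rewrite lerDr.
set E2 := (X in `|X| <= _ -> _); move=> n2.
set E1 := (X in `|X| <= _ -> _); move=> n1.
set z := (g1 x y +i* g2 x y)%C in HF *.
pose h : Cplx R := ((g1 x' y' - g1 x y) +i* (g2 x' y' - g2 x y))%C.
have -> : (g1 x' y' +i* g2 x' y')%C = z + h by rewrite /z /h; simpc; rewrite !subrKC.
have hE : h = ((A1 * X + B1 * Y) +i* (A2 * X + B2 * Y))%C + (E1 +i* E2)%C.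
  by rewrite /h /E1 /E2; apply: complex_ext => /=; ring.
have cE : cmod (E1 +i* E2)%C <= 2 * e' * S.
  by rewrite (le_trans (cmod_leD _))//= -mulrA mulr_natl mulr2n lerD.
have ch : cmod h <= 3 * K * S.
  rewrite hE (le_trans (cmodD _ _))//.
  have : cmod ((A1 * X + B1 * Y) +i* (A2 * X + B2 * Y))%C <= (K - 1) * S.
    rewrite (le_trans (cmod_leD _))//=.
    rewrite (@le_trans _ _ (`|A1 * X| + `|B1 * Y| + (`|A2 * X| + `|B2 * Y|)))//.
      by rewrite lerD// ler_normD.
    rewrite !normrM /K.
    have q (k l : R) : `|l| <= S -> `|k| * `|l| <= `|k| * S by move=> ?; rewrite ler_wpM2l.
    have := q A1 _ XS; have := q A2 _ XS; have := q B1 _ YS; have := q B2 _ YS; lra.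
  have : e' * S <= 1 * S by rewrite ler_wpM2r.
  have : 1 * S <= K * S by rewrite ler_wpM2r.
  lra.
have chd : cmod h < dl.
  apply: (le_lt_trans ch).
  by move: xK yK; rewrite !ltr_pdivlMr ?mulr_gt0// /S; lra.
have := HF _ chd; set G := _ - _ - _ => Gh.
have -> : ReC (u * F (z + h)) - ReC (u * F z) - ReC (u * d * (A1 +i* A2)%C) * X -
   ReC (u * d * (B1 +i* B2)%C) * Y = ReC (u * (G + d * (E1 +i* E2)%C)).
  have -> : F (z + h) = G + F z + d * h by rewrite /G; ring.
  by rewrite hE; rewrite !ReImE /=; ring.
rewrite (le_trans (normr_Re _))// cmodM.
have cG : cmod (G + d * (E1 +i* E2)%C) <= (cmod d + 1) * (3 * K * e' * S).
  rewrite (le_trans (cmodD _ _))// cmodM.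
  have : cmod G <= 3 * K * e' * S.
    rewrite (le_trans Gh)// (le_trans (ler_wpM2l (ltW e'0) ch))//.
    by rewrite le_eqVlt; apply/orP; left; apply/eqP; ring.
  have : cmod d * cmod (E1 +i* E2)%C <= cmod d * (3 * K * e' * S).
    rewrite ler_wpM2l ?cmod_ge0// (le_trans cE)//.
    have : 1 * (e' * S) <= K * (e' * S) by rewrite ler_wpM2r// mulr_ge0// ltW.
    have : 0 <= e' * S by rewrite mulr_ge0// ltW.
    lra.
  lra.
rewrite (le_trans (ler_wpM2l (cmod_ge0 u) cG))//.
have : M * (3 * K * e' * S) <= e * S.
  have : e' * (6 * M * K) * S <= e * S by rewrite ler_wpM2r.
  have : 0 <= e' * (6 * M * K) * S by rewrite !mulr_ge0// ltW.
  lra.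
apply: le_trans; rewrite mulrA ler_wpM2r ?mulr_ge0 ?(ltW e'0) ?(ltW K0)//.
by rewrite /M lerDl.
Qed.

End circle.

(** * Means over circles and the derivative of a function with nonnegative real part *)

Section minimum_principle.
Context {R : realType}.
Implicit Types (z a d c L : Cplx R) (e x y r : R) (F f : Cplx R -> Cplx R).

Definition circ_pt a r y : Cplx R :=
  ((ReC a + r * cos y) +i* (ImC a + r * sin y))%C.

Lemma circ_ptB a r y : circ_pt a r y - a = ((r * cos y) +i* (r * sin y))%C.
Proof. by apply: complex_ext; rewrite !ReImE /=; ring. Qed.

Lemma cmod_circ_ptB a r y : 0 <= r -> cmod (circ_pt a r y - a) = r.
Proof.
move=> r0; rewrite circ_ptB cmodE /= !exprMn -mulrDr cos2Dsin2 mulr1.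
by rewrite sqrtr_sqr ger0_norm.
Qed.

(* In the coordinates (log r, theta) around [a], the Cauchy-Riemann equations for [F]
   say that Im F dx + Re F dy is closed. *)
Lemma circle_closed F a x0 x1 y0 y1 :
  (forall z, 0 < cmod (z - a) <= expR x1 -> derivable F z 1) ->
  closed_on (fun x y => ImC (F (circ_pt a (expR x) y)))
            (fun x y => ReC (F (circ_pt a (expR x) y))) x0 x1 y0 y1.
Proof.
move=> dF x y; rewrite in_itv /= => /andP[_ xx1] _.
have /dF/derivable_cder : 0 < cmod (circ_pt a (expR x) y - a) <= expR x1.
  by rewrite cmod_circ_ptB ?expR_ge0// expR_gt0 ler_expR.
set d := 'D_1 F _ => HF.
have g1 := diff2_cst_add (ReC a) (diff2_mul (is_derive_expR x) (is_derive_cos y)).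
have g2 := diff2_cst_add (ImC a) (diff2_mul (is_derive_expR x) (is_derive_sin y)).
have HF2 u := @diff2_cder _ F (fun x y => ReC a + expR x * cos y)
  (fun x y => ImC a + expR x * sin y) x y _ _ _ _ _ u HF g1 g2.
have Q := HF2 1; have P := HF2 (0 +i* (-1))%C.
exists (ReC ((0 +i* (-1)) * d * ((expR x * cos y) +i* (expR x * sin y)))%C).
exists (ReC ((0 +i* (-1)) * d * ((expR x * - sin y) +i* (expR x * cos y)))%C).
exists (ReC (1 * d * ((expR x * - sin y) +i* (expR x * cos y)))%C).
split.
  rewrite (_ : (fun x y => ImC _) =
    fun x y => ReC ((0 +i* (-1))%C * F (circ_pt a (expR x) y))) //.
  by apply/funext => u; apply/funext => v; rewrite !ReImE /=; ring.
rewrite (_ : (fun x y => ReC _) = fun x y => ReC (1 * F (circ_pt a (expR x) y))).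
  rewrite (_ : ReC ((0 +i* (-1)) * d * _)%C =
    ReC (1 * d * ((expR x * cos y) +i* (expR x * sin y)))%C) //.
  by rewrite !ReImE /=; ring.
by apply/funext => u; apply/funext => v; rewrite mul1r.
Qed.

(** In logarithmic polar coordinates the annulus is a rectangle. Its sides at angles 0 and [T] are
    the same segment of the plane, so their contributions cancel, and Goursat leaves the difference
    of the integrals over the two circles. *)
Lemma circle_mean_const F a r0 r1 T : 0 < r0 -> r0 <= r1 ->
  0 <= T -> cos T = 1 -> sin T = 0 ->
  (forall z, 0 < cmod (z - a) <= r1 -> derivable F z 1) ->
  seg_int (fun y => ReC (F (circ_pt a r0 y))) 0 T =
  seg_int (fun y => ReC (F (circ_pt a r1 y))) 0 T.
Proof.
move=> r00 r01 T0 cT sT; have r10 := lt_le_trans r00 r01.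
have := goursat; move: (@circle_closed F a (ln r0) (ln r1) 0 T).
have : ln r0 <= ln r1 by rewrite ler_ln ?posrE.
have := lnK r00; have := lnK r10.
move: (ln r0) (ln r1) (@expR R) => x0 x1 E E1 E0 xx; rewrite E1 => H gour dF.
have {}H := H dF.
have := gour _ _ _ _ _ _ _ xx T0 H; rewrite /circ E0 E1.
have -> : (fun x => ImC (F (circ_pt a (E x) 0)) - ImC (F (circ_pt a (E x) T))) = fun=> 0.
  by apply/funext => x; rewrite /circ_pt cos0 sin0 cT sT subrr.
rewrite (seg_int_cst 0 xx) mul0r add0r seg_intB.
- by move=> /subr0_eq ->.
- move=> y yi; rewrite -E1; apply: (closed_on_contQy H _ yi).
  by rewrite in_itv /= lexx andbT.
- move=> y yi; rewrite -E0; apply: (closed_on_contQy H _ yi).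
  by rewrite in_itv /= lexx.
Qed.

Lemma circle_cts F a r y :
  derivable F (circ_pt a r y) 1 ->
  {for y, continuous (fun y => ReC (F (circ_pt a r y)))}.
Proof.
move=> /derivable_cder HF.
have g1 := diff2_cst_add (ReC a) (diff2_mul (is_derive_id r 1) (is_derive_cos y)).
have g2 := diff2_cst_add (ImC a) (diff2_mul (is_derive_id r 1) (is_derive_sin y)).
have := @diff2_cder _ F (fun r y => ReC a + r * cos y)
  (fun r y => ImC a + r * sin y) r y _ _ _ _ _ 1 HF g1 g2.
move/diff2_continuousr.
have -> // : (fun y0 => ReC (1 * F ((ReC a + r * cos y0) +i* (ImC a + r * sin y0))%C)) =
  (fun y => ReC (F (circ_pt a r y))).
by apply/funext => v; rewrite mul1r.
Qed.

(* Nothing is assumed on the value [F a], so [F] may involve quotients by [z - a]. *)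
Lemma circle_min F a r L : 0 < r ->
  (forall z, 0 < cmod (z - a) <= r -> derivable F z 1) ->
  (forall e, 0 < e -> exists2 d, 0 < d &
    forall z, 0 < cmod (z - a) < d -> cmod (F z - L) <= e) ->
  (forall y, 0 <= ReC (F (circ_pt a r y))) -> 0 <= ReC L.
Proof.
move=> r0 dF FL pos; rewrite leNgt; apply/negP => L0.
have [T [T0 cT sT]] : exists T : R, [/\ 0 < T, cos T = 1 & sin T = 0].
  by exists (pi *+ 2); rewrite mulrn_wgt0 ?pi_gt0 ?cos2pi ?sin2pi.
(* If Re L < 0, then on a small circle Re F is within |Re L| / 2 of Re L, so its integral is
   negative, whereas on the circle of radius [r] the equal integral is nonnegative. *)
have e0 : 0 < - ReC L / 2 by lra.
have [d d0 {}FL] := FL _ e0.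
pose s := Num.min r (d / 2).
have s0 : 0 < s by rewrite lt_min r0 divr_gt0.
have sr : s <= r by rewrite ge_min lexx.
have sd : s < d by rewrite gt_min; apply/orP; right; lra.
clearbody s.
have E := circle_mean_const s0 sr (ltW T0) cT sT dF.
have i1 : 0 <= seg_int (fun y => ReC (F (circ_pt a r y))) 0 T.
  by apply: Rintegral_ge0 => y _; exact: pos.
have := @seg_int_near _ (fun y => ReC (F (circ_pt a s y))) (ReC L) (- ReC L / 2)
  0 T (ltW T0).
rewrite subr0 E => near.
have {near} : `|seg_int (fun y => ReC (F (circ_pt a r y))) 0 T
  - ReC L * T| <= - ReC L / 2 * T.
  apply: near => y yi.
    by apply: circle_cts; apply: dF; rewrite cmod_circ_ptB ?(ltW s0)// s0 sr.
  have := FL (circ_pt a s y); rewrite cmod_circ_ptB ?(ltW s0)// s0 sd => /(_ isT).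
  by apply: le_trans; rewrite -Re_opp -Re_add; exact: normr_Re.
rewrite ler_norml => /andP[_]; rewrite lerBlDr -mulrDl => h.
have := le_trans i1 h; rewrite pmulr_lge0//; lra.
Qed.

Lemma derivable_subC f g z : derivable f z 1 -> derivable g z 1 ->
  derivable (fun z => f z - g z : Cplx R) z 1.
Proof. exact: derivableB. Qed.

Lemma derivable_mulC f g z : derivable f z 1 -> derivable g z 1 ->
  derivable (fun z => f z * g z : Cplx R) z 1.
Proof. exact: derivableM. Qed.

Lemma derivable_invC f z : f z != 0 -> derivable f z 1 ->
  derivable (fun z => (f z)^-1 : Cplx R) z 1.
Proof. exact: derivableV. Qed.

Lemma derivable_cstC c z : derivable (fun=> c : Cplx R) z 1.
Proof. exact: derivable_cst. Qed.

Lemma derivable_cts F z : derivable F z 1 -> forall e, 0 < e ->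
  exists2 d, 0 < d & forall z', cmod (z' - z) < d -> cmod (F z' - F z) <= e.
Proof.
move=> /derivable_cder H e e0; set k := cmod ('D_1 F z) + 1.
have k0 : 0 < k by rewrite ltr_wpDl ?cmod_ge0.
have [d d0 {}H] := H 1 ltr01.
exists (Num.min d (e / k)); first by rewrite lt_min d0 divr_gt0.
move=> z'; rewrite lt_min ltr_pdivlMr// => /andP[/H]; rewrite subrKC mul1r => h1 h2.
rewrite -(subrK ('D_1 F z * (z' - z)) (F z' - F z)).
rewrite (le_trans (cmodD _ _))// cmodM.
have E : cmod (z' - z) * k = cmod ('D_1 F z) * cmod (z' - z) + cmod (z' - z).
  by rewrite /k mulrDr mulr1 mulrC.
apply: le_trans (ltW h2); rewrite E addrC lerD2l //.
Qed.

Lemma derivable_kernel f a z c1 c2 c3 c4 : derivable f z 1 -> z - a != 0 ->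
  derivable (fun z => f z - c1 * ((f z - c4) * (z - a)^-1) - c2 * ((z - a) * f z)
    - c3 * (z - a) : Cplx R) z 1.
Proof.
move=> df za.
have der_sub : derivable (fun z => z - a : Cplx R) z 1.
  by apply: derivable_subC; [exact: derivable_id|exact: derivable_cstC].
have dc c : derivable (fun=> c : Cplx R) z 1 by exact: derivable_cstC.
have dfc := derivable_subC df (dc c4).
have di := @derivable_invC (fun z => z - a) z za der_sub.
have k1 := derivable_mulC (dc c1) (derivable_mulC dfc di).
have k2 := derivable_mulC (dc c2) (derivable_mulC der_sub df).
have k3 := derivable_mulC (dc c3) der_sub.
exact: (derivable_subC (derivable_subC (derivable_subC df k1) k2) k3).
Qed.

(** The difference quotient tends to f'(a), and the terms with a factor [z - a] vanish. Four errors
    arise, each given [e / 4]. *)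
Lemma kernel_limit f a c1 c2 c3 e : 0 < e -> derivable f a 1 ->
  exists2 d, 0 < d & forall z, 0 < cmod (z - a) < d ->
  cmod (f z - c1 * ((f z - f a) * (z - a)^-1) - c2 * ((z - a) * f z)
    - c3 * (z - a) - (f a - c1 * 'D_1 f a)) <= e.
Proof.
move=> e0 df; set D := 'D_1 f a.
pose K1 := cmod c1 + 1; pose K2 := cmod c2 * (cmod (f a) + 1) + 1.
pose K3 := cmod c3 + 1.
have K10 : 0 < K1 by rewrite ltr_wpDl ?cmod_ge0.
have K20 : 0 < K2 by rewrite ltr_wpDl ?mulr_ge0 ?addr_ge0 ?cmod_ge0.
have K30 : 0 < K3 by rewrite ltr_wpDl ?cmod_ge0.
have e4 : 0 < e / 4 by rewrite divr_gt0.
have m0 : 0 < Num.min 1 (e / 4) by rewrite lt_min ltr01.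
have [d1 d10 H1] := derivable_cts df m0.
have [d2 d20 H2] := derivable_cder df (divr_gt0 e4 K10).
exists (Num.min (Num.min d1 d2) (Num.min (e / 4 / K2) (e / 4 / K3))).
  by rewrite !lt_min d10 d20 !divr_gt0.
move=> z /andP[z0]; rewrite !lt_min.
move=> /andP[/andP[zd1 zd2] /andP[]].
rewrite (ltr_pdivlMr _ _ K20) (ltr_pdivlMr _ _ K30) => h3 h4.
have := H1 _ zd1; rewrite le_min => /andP[h1 h1'].
have := H2 _ zd2; rewrite subrKC -/D => h2.
have za : z - a != 0 by rewrite -cmod_gt0.
set u := f z - f a in h1 h1' h2 *; set w := z - a in h2 h3 h4 z0 za *.
have fzE : f z = f a + u by rewrite /u subrKC.
have -> : f z - c1 * (u * w^-1) - c2 * (w * f z) - c3 * w - (f a - c1 * D) =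
  u - c1 * ((u - D * w) * w^-1) - c2 * (w * f z) - c3 * w.
  have -> : (u - D * w) * w^-1 = u * w^-1 - D by rewrite mulrBl mulfK.
  by rewrite fzE; ring.
have t2 : cmod (c1 * ((u - D * w) * w^-1)) <= e / 4.
  rewrite !cmodM Normc.normcV mulrA ler_pdivrMr//.
  have : cmod c1 * cmod (u - D * w) <= K1 * (e / 4 / K1 * cmod w).
    by rewrite ler_pM ?cmod_ge0// lerDl.
  have -> // : K1 * (e / 4 / K1 * cmod w) = e / 4 * cmod w.
  by field; rewrite gt_eqF.
have t3 : cmod (c2 * (w * f z)) <= e / 4.
  rewrite !cmodM mulrCA; apply: le_trans (ltW h3).
  rewrite ler_wpM2l ?cmod_ge0// /K2.
  have : cmod c2 * cmod (f z) <= cmod c2 * (cmod (f a) + 1).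
    rewrite ler_wpM2l ?cmod_ge0// fzE (le_trans (cmodD _ _))// lerD2l//.
  lra.
have t4 : cmod (c3 * w) <= e / 4.
  rewrite cmodM mulrC; apply: le_trans (ltW h4).
  by rewrite ler_wpM2l ?cmod_ge0// lerDl.
have tB (p q : Cplx R) : cmod (p - q) <= cmod p + cmod q.
  by rewrite (le_trans (cmodD _ _))// normcN.
apply: le_trans (tB _ _) _.
apply: le_trans (lerD (tB _ _) (lexx _)) _.
apply: le_trans (lerD (lerD (tB _ _) (lexx _)) (lexx _)) _.
move: t2 t3 t4 h1'; move: (cmod u) (cmod (c1 * _)) (cmod (c2 * _)) (cmod (c3 * _)).
move=> x1 x2 x3 x4; lra.
Qed.

Lemma unit_dot (p q u v : R) : p ^+ 2 + q ^+ 2 = 1 -> u ^+ 2 + v ^+ 2 = 1 ->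
  0 <= 1 - (p * u + q * v).
Proof.
move=> pq uv; have := addr_ge0 (sqr_ge0 (p - u)) (sqr_ge0 (q - v)).
have -> : (p - u) ^+ 2 + (q - v) ^+ 2 =
  p ^+ 2 + q ^+ 2 + (u ^+ 2 + v ^+ 2) - 2 * (p * u + q * v) by ring.
rewrite pq uv; lra.
Qed.

(** The average of Re f over the circle against the nonnegative weight 1 - Re (c e^(- i y)), where c
    is the unit number making c f'(a) equal to |f'(a)|, is Re f(a) - r |f'(a)| / 2. To realise it as
    a limit at [a], f(a) is subtracted before dividing by [z - a]; the term with [c3] removes the
    real part that this subtraction adds on the circle. *)
Lemma derive_bound_Re f a r : 0 < r ->
  (forall z, cmod (z - a) <= r -> derivable f z 1) ->
  (forall z, cmod (z - a) <= r -> 0 <= ReC (f z)) ->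
  cmod ('D_1 f a) * r <= 2 * ReC (f a).
Proof.
move=> r0 df f0; set D := 'D_1 f a.
have fa0 : 0 <= ReC (f a) by apply: f0; rewrite subrr cmod0 ltW.
have [D0|D0] := eqVneq D 0; first by rewrite D0 cmod0 mul0r mulr_ge0.
have nD : cmod D != 0 by rewrite cmod_eq0.
pose p := ReC D / cmod D; pose q := - (ImC D) / cmod D.
have pq : p ^+ 2 + q ^+ 2 = 1.
  by rewrite /p /q !exprMn sqrrN -mulrDl -sqr_cmod -exprMn divff ?expr1n.
pose c : Cplx R := (p +i* q)%C.
have cD : ReC (c * D) = cmod D.
  rewrite Re_mul /= /p /q; apply: (mulIf nD).
  by rewrite -expr2 sqr_cmod; field.
pose c1 : Cplx R := ((p * r / 2) +i* (q * r / 2))%C.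
pose c2 : Cplx R := ((p / (2 * r)) +i* (- q / (2 * r)))%C.
pose c3 : Cplx R := (ReC (c * f a) / (2 * r) +i* (- ImC (c * f a) / (2 * r)))%C.
(* With c1 = c r / 2, c2 = c^* / (2 r) and c3 = (c f(a))^* / (2 r), the real part of [F]
   at a + r e^(i y) is Re f (1 - Re (c e^(- i y))) >= 0, and F tends to
   f(a) - c r f'(a) / 2 at [a]. *)
pose F : Cplx R -> Cplx R := fun z =>
  f z - c1 * ((f z - f a) * (z - a)^-1) - c2 * ((z - a) * f z) - c3 * (z - a).
have ca : cmod (a - a) <= r by rewrite subrr cmod0 ltW.
suff : 0 <= ReC (f a - c1 * D).
  have -> : ReC (f a - c1 * D) = ReC (f a) - cmod D * r / 2.
    by rewrite -cD !ReImE /=; field.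
  by rewrite subr_ge0 ler_pdivrMr// mulrC [X in _ <= X]mulrC mulrC [X in _ <= X]mulrC.
apply: (@circle_min F a r) => //.
- move=> z /andP[z0 zr].
  have za : z - a != 0 by rewrite -cmod_gt0.
  have dfz := df _ zr.
  exact: derivable_kernel.
- move=> e e0; apply: kernel_limit => //; exact: df _ ca.
- move=> y.
  have C1 := @cos2Dsin2 R y.
  have fz0 : 0 <= ReC (f (circ_pt a r y)) by apply: f0; rewrite (cmod_circ_ptB _ _ (ltW r0)).
  have inv : (circ_pt a r y - a)^-1 = ((cos y / r) +i* (- sin y / r))%C.
    apply: (@mulIf _ (circ_pt a r y - a)).
      by rewrite -cmod_gt0 (cmod_circ_ptB _ _ (ltW r0)).
    rewrite mulVf; last by rewrite -cmod_gt0 (cmod_circ_ptB _ _ (ltW r0)).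
    rewrite circ_ptB; apply: complex_ext; rewrite !ReImE /=; last by field; rewrite gt_eqF.
    by rewrite -C1; field; rewrite gt_eqF.
  rewrite /F inv circ_ptB.
  move: fz0; case: (f (circ_pt a r y)) => u v /= u0.
  have -> : ReC ((u +i* v)%C - c1 * (((u +i* v)%C - f a) * ((cos y / r) +i* (- sin y / r))%C)
     - c2 * (((r * cos y) +i* (r * sin y))%C * (u +i* v)%C)
     - c3 * ((r * cos y) +i* (r * sin y))%C) = u * (1 - (p * cos y + q * sin y)).
    by rewrite !ReImE /= !ReImE /=; field; rewrite gt_eqF.
  by apply: mulr_ge0 => //; exact: unit_dot.
Qed.

End minimum_principle.

(** * Bounds that are uniform over the class P *)

Section class_P_bounds.
Context {R : realType}.
Implicit Types (z a d c v : Cplx R) (e x y r rho : R) (F f : Cplx R -> Cplx R).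

Lemma approx_is_derive (f : R -> R) x (df : R) :
  (forall e, 0 < e -> exists2 d, 0 < d & forall x', `|x' - x| < d ->
    `|f x' - f x - df * (x' - x)| <= e * `|x' - x|) -> is_derive x 1 f df.
Proof.
move=> H.
have cv : (fun h : R => h^-1 *: (f (h *: (1 : R) + x) - f x)) @ 0^' --> df.
  apply/(@cvgrPdist_le _ R^o) => e /H[d d0 {}H]; exists d => //= h.
  rewrite /ball_ /= sub0r normrN => hd h0.
  have := H (h + x); rewrite addrK => /(_ hd).
  rewrite /GRing.scale /= mulr1 -ler_pdivrMr ?normr_gt0// -normfV -normrM distrC.
  by rewrite mulrBl mulfK// mulrC.
apply: DeriveDef; first by apply/cvg_ex; exists df.
exact: (cvg_lim _ cv).
Qed.

Lemma mvt01 (g dg : R -> R) : (forall s : R, 0 <= s <= 1 -> is_derive s 1 g (dg s)) ->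
  exists2 s : R, 0 <= s <= 1 & g 1 - g 0 = dg s.
Proof.
move=> H; have [|||s] := @MVT_segment _ g dg 0 1; first exact: ler01.
- by move=> x; rewrite in_itv /= => /andP[x0 x1]; apply: H; rewrite !ltW.
- by apply: derivable_within_continuous => x; rewrite in_itv /= => /H [].
- by rewrite in_itv /= subr0 mulr1; exists s.
Qed.

Lemma is_derive_segment f z v c (s : R) : derivable f (z + (s%:C)%C * v) 1 ->
  is_derive s 1 (fun s => ReC (c * f (z + (s%:C)%C * v)))
    (ReC (c * ('D_1 f (z + (s%:C)%C * v) * v))).
Proof.
move=> /derivable_cder; set D := 'D_1 f _; set w := z + _ => H.
apply: approx_is_derive => e e0.
pose k := cmod v + 1; have k0 : 0 < k by rewrite ltr_wpDl ?cmod_ge0.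
pose l := cmod c + 1; have l0 : 0 < l by rewrite ltr_wpDl ?cmod_ge0.
have [d d0 {}H] := H _ (divr_gt0 e0 (mulr_gt0 l0 k0)).
exists (d / k); first by rewrite divr_gt0.
move=> s'; rewrite ltr_pdivlMr// => sd.
pose h : Cplx R := ((s' - s)%:C)%C * v.
have hE : cmod h = `|s' - s| * cmod v by rewrite cmodM cmod_real.
have hd : cmod h < d.
  by rewrite hE; apply: le_lt_trans sd; rewrite ler_wpM2l// lerDl.
have -> : z + (s'%:C)%C * v = w + h.
  by rewrite /w /h rmorphB /= mulrBl addrA addrAC addrK.
have := H _ hd; set g := _ - _ - _ => gh.
have -> : ReC (c * f (w + h)) - ReC (c * f w) - ReC (c * (D * v)) * (s' - s) =
  ReC (c * g).
  by rewrite /g /h !ReImE /=; ring.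
rewrite (le_trans (normr_Re _))// cmodM.
have : cmod c * cmod g <= l * (e / (l * k) * cmod h).
  by rewrite ler_pM ?cmod_ge0// lerDl.
move=> /le_trans; apply.
have -> : l * (e / (l * k) * cmod h) = e * (cmod h / k).
  by field; rewrite !gt_eqF.
by rewrite ler_pM2l// ler_pdivrMr// hE ler_wpM2l// lerDl.
Qed.

(** Take c to be the conjugate of d divided by |d|. This lets the real mean value theorem and real
    monotonicity act on complex-valued functions. *)
Lemma cmod_dual d (k : R) :
  (forall c, cmod c <= 1 -> ReC (c * d) <= k) -> cmod d <= k.
Proof.
move=> H; have [D0|D0] := eqVneq d 0.
  by have := H 0; rewrite mul0r cmod0 D0 cmod0; apply.
have nD : 0 < cmod d by rewrite cmod_gt0.
have := H (ReC d / cmod d +i* (- ImC d / cmod d))%C.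
have -> : ReC ((ReC d / cmod d +i* (- ImC d / cmod d))%C * d) = cmod d.
  rewrite Re_mul /=; apply: (mulIf (lt0r_neq0 nD)).
  by rewrite -expr2 sqr_cmod; field; rewrite gt_eqF.
apply; rewrite ler_sqr_cmod//= !exprMn sqrrN -mulrDl -sqr_cmod -exprMn divff ?gt_eqF//.
Qed.

Lemma class_P_derive f rho z : rho < 1 -> class_P f -> cmod z <= rho ->
  cmod ('D_1 f z) <= 4 / (1 - rho) * ReC (f z).
Proof.
move=> rho1 [fan f0 fpos] zr.
(* Half the distance to the circle keeps the closed disc around [z] inside the unit disc; this half
   turns the constant 2 of [derive_bound_Re] into 4. *)
have r0 : 0 < (1 - rho) / 2 by lra.
have inD z' : cmod (z' - z) <= (1 - rho) / 2 -> unit_disc z'.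
  move=> h; rewrite /unit_disc /= -(subrK z z') (le_lt_trans (cmodD _ _))//.
  by move: h zr; lra.
have := @derive_bound_Re _ f z _ r0 (fun z' h => fan z' (inD z' h))
  (fun z' h => ltW (fpos z' (inD z' h))).
rewrite -ler_pdivlMr// => /le_trans; apply.
by rewrite le_eqVlt; apply/orP; left; apply/eqP; field; rewrite gt_eqF//; lra.
Qed.

(** By [class_P_derive], the logarithm of Re f has derivative at most [4 / (1 - rho)] along the
    segment from 0 to [z], and it starts at 0 because [f 0 = 1]. *)
Lemma class_P_growth f rho z : rho < 1 -> class_P f -> cmod z <= rho ->
  ReC (f z) <= expR (4 / (1 - rho)).
Proof.
move=> rho1 fP zr; have [fan f0 fpos] := fP.
have sz (s : R) : 0 <= s <= 1 -> cmod (0 + (s%:C)%C * z) <= rho.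
  move=> /andP[s0 s1]; rewrite add0r cmodM cmod_real ger0_norm//.
  by apply: le_trans zr; rewrite ler_piMl// cmod_ge0.
have sD (s : R) : 0 <= s <= 1 -> unit_disc (0 + (s%:C)%C * z).
  by move=> /sz h; exact: le_lt_trans rho1.
pose phi (s : R) : R := ReC (1 * f (0 + (s%:C)%C * z)).
pose dphi (s : R) : R := ReC (1 * ('D_1 f (0 + (s%:C)%C * z) * z)).
have phi0 (s : R) : 0 <= s <= 1 -> 0 < phi s by move=> /sD/fpos; rewrite /phi mul1r.
have dlog (s : R) : 0 <= s <= 1 -> is_derive s 1 (@ln R \o phi) ((phi s)^-1 * dphi s).
  move=> s01; have d1 := is_derive1_ln (phi0 _ s01).
  have d2 : is_derive s 1 phi (dphi s) by apply: is_derive_segment; apply: fan; exact: sD.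
  exact: is_derive1_comp.
have [s s01] := mvt01 dlog; rewrite /= => E.
have p0 : phi 0 = 1 by rewrite /phi mul1r mul0r addr0 f0.
have p1 : phi 1 = ReC (f z) by rewrite /phi !mul1r add0r.
move: E; rewrite p0 p1 ln1 subr0 => E.
have fz0 : 0 < ReC (f z) by apply: fpos; exact: le_lt_trans rho1.
rewrite -(lnK fz0) ler_expR E mulrC ler_pdivrMr ?phi0//.
rewrite (le_trans (ler_norm _))// (le_trans (normr_Re _))// mul1r cmodM.
have := class_P_derive rho1 fP (sz _ s01); rewrite /phi mul1r; apply: le_trans.
by rewrite ler_piMr ?cmod_ge0// ltW// (le_lt_trans zr).
Qed.

Lemma class_P_lipschitz rho : 0 <= rho -> rho < 1 -> exists2 L, 0 <= L &
  forall f z z', class_P f -> cmod z <= rho -> cmod z' <= rho ->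
    cmod (z * f z - z' * f z') <= L * cmod (z - z').
Proof.
move=> rho0 rho1; pose K := 4 / (1 - rho).
have K0 : 0 <= K by rewrite divr_ge0// subr_ge0 ltW.
pose M := K * expR K; have M0 : 0 <= M by rewrite mulr_ge0// expR_ge0.
(* On the disc of radius [rho], [M] bounds |f'| and [M + 1] bounds |f|, as [f 0 = 1]. These are the
   two terms of the product rule; neither depends on [f]. *)
exists (M + (M + 1)); first by rewrite !addr_ge0.
move=> f z1 z2 fP z1r z2r; have [fan f0 fpos] := fP.
have dM z : cmod z <= rho -> cmod ('D_1 f z) <= M.
  move=> zr; rewrite (le_trans (class_P_derive rho1 fP zr))//.
  by rewrite ler_wpM2l// class_P_growth.
have lip z z' : cmod z <= rho -> cmod z' <= rho ->
    cmod (f z' - f z) <= M * cmod (z' - z).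
  move=> zr zr'; apply: cmod_dual => c c1.
  have sz (s : R) : 0 <= s <= 1 -> cmod (z + (s%:C)%C * (z' - z)) <= rho.
    move=> /andP[s0 s1].
    have -> : z + (s%:C)%C * (z' - z) = ((1 - s)%:C)%C * z + (s%:C)%C * z'.
      by rewrite rmorphB rmorph1; ring.
    rewrite (le_trans (cmodD _ _))// !cmodM !cmod_real !ger0_norm ?subr_ge0//.
    have : (1 - s) * cmod z <= (1 - s) * rho by rewrite ler_wpM2l// subr_ge0.
    have : s * cmod z' <= s * rho by rewrite ler_wpM2l.
    lra.
  have [s s01] := @mvt01 (fun s => ReC (c * f (z + (s%:C)%C * (z' - z))))
     (fun s => ReC (c * ('D_1 f (z + (s%:C)%C * (z' - z)) * (z' - z))))
     (fun s s01 => is_derive_segment c (fan _ (le_lt_trans (sz s s01) rho1))).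
  have E1 : z + (1%:C)%C * (z' - z) = z' by rewrite mul1r subrKC.
  have E0 : z + (0%:C)%C * (z' - z) = z by rewrite mul0r addr0.
  rewrite E1 E0 (mulrBr c) Re_add Re_opp => ->.
  rewrite (le_trans (ler_norm _))// (le_trans (normr_Re _))// !cmodM.
  have : cmod c * (cmod ('D_1 f (z + (s%:C)%C * (z' - z))) * cmod (z' - z)) <=
    1 * (M * cmod (z' - z)).
    rewrite ler_pM ?mulr_ge0 ?cmod_ge0// ler_wpM2r ?cmod_ge0//.
    exact/dM/sz.
  by rewrite mul1r.
have f2 : cmod (f z2) <= M + 1.
  rewrite -(subrK (f 0) (f z2)) (le_trans (cmodD _ _))// f0 Normc.normc1 lerD2r.
  rewrite -f0 (le_trans (lip _ _ _ _))// ?cmod0// subr0 ler_piMr//.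
  by rewrite ltW// (le_lt_trans z2r).
have -> : z1 * f z1 - z2 * f z2 = z1 * (f z1 - f z2) + (z1 - z2) * f z2 by ring.
rewrite (le_trans (cmodD _ _))// !cmodM mulrDl lerD//; last first.
  by rewrite mulrC ler_wpM2r ?cmod_ge0.
have := lip _ _ z2r z1r; apply: le_trans.
by rewrite ler_piMl ?cmod_ge0// ltW// (le_lt_trans z1r).
Qed.

End class_P_bounds.

(** * Absolutely continuous functions *)

Section ac_monotone.
Context {R : realType}.
Implicit Types (f : R -> R) (a b c e : R) (s : seq (R * R)).
Local Notation mu := (@lebesgue_measure R).

Definition real_ac a b f := forall e, 0 < e -> exists2 d, 0 < d &
  forall (n : nat) (x y : 'I_n -> R),
    (forall i, [/\ a <= x i, x i < y i & y i <= b]) ->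
    trivIset [set: 'I_n] (fun i => `]x i, y i[%classic) ->
    \sum_(i < n) (y i - x i) < d ->
    \sum_(i < n) `|f (y i) - f (x i)| < e.

(** Transfers absolute continuity from trajectories to the real quantities that are shown to be
    monotone. The term [y - x] accounts for an explicit dependence on time. *)
Lemma real_ac_dominated a b f (w1 w2 : R -> Cplx R) K : 0 <= K ->
  absolutely_continuous a b w1 -> absolutely_continuous a b w2 ->
  (forall x y, a <= x -> x < y -> y <= b ->
    `|f y - f x| <= K * (cmod (w1 y - w1 x) + cmod (w2 y - w2 x) + (y - x))) ->
  real_ac a b f.
Proof.
move=> K0 A1 A2 dom e e0; pose k := e / (3 * (K + 1)).
have K10 : 0 < K + 1 by lra.
have k0 : 0 < k by rewrite divr_gt0// mulr_gt0.
have [d1 d10 H1] := A1 _ k0; have [d2 d20 H2] := A2 _ k0.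
exists (Num.min (Num.min d1 d2) k); first by rewrite !lt_min d10 d20.
move=> n x y xy tr; rewrite !lt_min => /andP[/andP[s1 s2] s3].
have := H1 n x y xy tr s1; have := H2 n x y xy tr s2 => h2 h1.
apply: (@le_lt_trans _ _ (K * (3 * k))); last first.
  rewrite /k (_ : K * _ = e * (K / (K + 1))); last by field; rewrite gt_eqF.
  by rewrite gtr_pMr// ltr_pdivrMr// mul1r ltrDl.
apply: (@le_trans _ _ (\sum_(i < n) K * (cmod (w1 (y i) - w1 (x i)) +
    cmod (w2 (y i) - w2 (x i)) + (y i - x i)))).
  by apply: ler_sum => i _; have [? ? ?] := xy i; exact: dom.
rewrite -mulr_sumr ler_wpM2l// !big_split /=.
by move: h1 h2 s3; rewrite big_split /= => *; lra.
Qed.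

(** Lists of intervals run from right to left, so that an interval added on the right is simply
    consed. *)
Definition seq_left (p q : R * R) := q.2 <= p.1.

Lemma real_ac_seq a b f : real_ac a b f -> forall e, 0 < e ->
  exists2 d, 0 < d & forall s,
    all (fun p => [&& a <= p.1, p.1 < p.2 & p.2 <= b]) s ->
    pairwise seq_left s ->
    \sum_(p <- s) (p.2 - p.1) < d ->
    \sum_(p <- s) `|f p.2 - f p.1| < e.
Proof.
move=> H e /H[d d0 {}H]; exists d => // s /all_nthP sab sl.
rewrite !(big_nth (0, 0)) !big_mkord; apply: H.
  by move=> i; have /and3P := sab (0, 0) i (ltn_ord i).
apply/trivIsetP => i j _ _ ij; apply/seteqP; split => // t /=.
rewrite !in_itv /= => -[/andP[t1 t2] /andP[t3 t4]].
have disj (k l : 'I_(size s)) : (k < l)%N -> (nth (0, 0) s k).1 < t ->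
    t < (nth (0, 0) s l).2 -> False.
  move=> lij u1 u2; have /(pairwiseP (0, 0)) := sl.
  move=> /(_ k l (ltn_ord k) (ltn_ord l) lij).
  by rewrite /seq_left leNgt (lt_trans u1 u2).
by move: ij; rewrite neq_lt => /orP[] lij; [exact: (disj i j)|exact: (disj j i)].
Qed.

(** The exceptional null set is enclosed in an open set so small that f varies by less than e over
    disjoint intervals of that total length; elsewhere the derivative allows a decrease of at most e
    per unit of length. A supremum argument along [a, b] combines the two. *)
Lemma ac_nondecreasing f a b : a <= b -> real_ac a b f ->
  {ae mu, forall t, a <= t <= b -> exists2 df : R, is_derive t 1 f df & 0 <= df} ->
  f a <= f b.
Proof.
move=> ab fac [A [mA A0 NA]].
suff small e : 0 < e -> f a - f b <= e * (b - a) + e.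
  rewrite -subr_le0; apply/ler_addgt0Pr => e e0; rewrite add0r.
  have k0 : 0 < b - a + 1 by lra.
  have := small _ (divr_gt0 e0 k0); move=> /le_trans; apply.
  by rewrite le_eqVlt; apply/orP; left; apply/eqP; field; rewrite gt_eqF.
move=> e0.
have [d d0 Hd] := real_ac_seq fac e0.
have [U [oU AU mUd]] : exists U : set R, [/\ open U, A `<=` U & (mu U < d%:E)%E].
  have muA : (mu A < +oo)%E by rewrite A0 ltry.
  have [U [oU AU mUA]] := lebesgue_regularity_outer mA muA d0.
  have E : mu U = (mu (U `\` A) + mu A)%E.
    rewrite -[in X in (_ + X)%E](setIidr AU).
    by apply: measureDI => //; exact: measurable_realfun.open_measurable.
  by exists U; split => //; rewrite E A0 adde0.
have mU := (measurable_realfun.open_measurable oU).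
(* [G c] holds when f has decreased on [a, c] by at most e (c - a), up to its variation
   on finitely many disjoint intervals lying in [U]; such partial covers extend past
   every point, by differentiability outside [A] and because [U] is open. *)
pose G c := [/\ a <= c, c <= b & exists s,
  [/\ all (fun p => [&& a <= p.1, p.1 < p.2 & p.2 <= c]) s, pairwise seq_left s,
      ((\sum_(p <- s) (p.2 - p.1))%:E <= mu (U `&` `]a, c]))%E &
      f a - f c <= e * (c - a) + \sum_(p <- s) `|f p.2 - f p.1| ]].
have Ga : G a.
  split => //; exists [::]; split => //; rewrite !big_nil; last first.
    by rewrite !subrr mulr0 addr0.
  exact: measure_ge0.
(* The extension starts left of [t] and ends right of it, since the supremum of the good points is
   not known to be good itself. If [t] lies in [A], the whole of ]c, c'[ lies in [U] and joins the
   list; otherwise the list is kept and the derivative at [t] pays. *)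
have step t : a <= t <= b -> exists2 dl, 0 < dl & forall c c',
    G c -> c <= t -> t <= c' -> c' <= b -> `|c - t| < dl -> `|c' - t| < dl -> G c'.
  move=> /andP[at' tb].
  have [At|nAt] := pselect (A t).
    have /nbhs_ballP[dl /= dl0 Ul] : nbhs t U by apply: open_nbhs_nbhs; split => //; exact: AU.
    exists dl => // c c' [ac cb [s [s1 s2 s3 s4]]] ct tc' c'b cd c'd.
    split => //; first lra.
    have [cc'|cc'] := ltP c c'; last first.
      have -> : c' = c by lra.
      by exists s.
    exists ((c, c') :: s); split.
    - rewrite /= ac cc' lexx /=; apply/allP => p /(allP s1) /and3P[-> -> pc] /=.
      by lra.
    - rewrite /= s2 andbT; apply/allP => p /(allP s1) /and3P[_ _ pc] //.
    - rewrite big_cons /= EFinD.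
      have mc : mu `]c, c'[ = (c' - c)%:E.
        by rewrite lebesgue_measure_itv /= lte_fin cc'.
      rewrite -mc; apply: (le_trans (leeD2l _ s3)).
      rewrite -measureU//; last 2 first.
      - exact: measurableI.
      - apply/seteqP; split => // u /=; rewrite !in_itv /= => -[/andP[? ?] [_ /andP[? ?]]].
        by lra.
      apply: le_measure; rewrite ?inE//.
      - by apply: measurableU => //; exact: measurableI.
      - exact: measurableI.
      move=> u /= [|[Uu]]; rewrite !in_itv /= => /andP[u1 u2]; split => //.
      + apply: Ul; rewrite /ball /= ltr_distl.
        by move: cd c'd; rewrite !ltr_distl => /andP[? ?] /andP[? ?]; apply/andP; split; lra.
      + by apply/andP; split; lra.
      + by apply/andP; split; lra.
    - rewrite big_cons /=; have := ler_norm (f c - f c'); rewrite distrC.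
      have : 0 <= e * (c' - c) by rewrite mulr_ge0// ?(ltW e0)// subr_ge0 ltW.
      move: s4; rewrite !mulrBr; move: (e * c) (e * c') (e * a) (\sum_(_ <- _) _) => *; lra.
  have [df Hdf df0] : exists2 df : R, is_derive t 1 f df & 0 <= df.
    apply: contrapT => nex; apply: nAt; apply: NA => /= H; apply: nex.
    by apply: H; rewrite at' tb.
  have [dl dl0 Hdl] := is_derive_approx Hdf e0.
  exists dl => // c c' [ac cb [s [s1 s2 s3 s4]]] ct tc' c'b cd c'd.
  split => //; first lra.
  exists s; split => //.
  - by apply/allP => p /(allP s1) /and3P[-> -> pc] /=; lra.
  - apply: (le_trans s3); apply: le_measure; rewrite ?inE//; try exact: measurableI.
    move=> u /= [Uu]; rewrite !in_itv /= => /andP[u1 u2]; split => //.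
    by apply/andP; split; lra.
  - have := Hdl _ cd; have := Hdl _ c'd; rewrite (ler0_norm (_ : c - t <= 0)) ?subr_le0//.
    rewrite (ger0_norm (_ : 0 <= c' - t)) ?subr_ge0//.
    have : 0 <= df * (c' - t) by rewrite mulr_ge0// subr_ge0.
    have : 0 <= df * (t - c) by rewrite mulr_ge0// subr_ge0.
    rewrite !ler_norml => p1 p2 /andP[q1 q2] /andP[q3 q4].
    move: s4 p1 p2 q1 q4; rewrite opprB !mulrBr.
    move: (\sum_(_ <- _) _) (e * _) (e * _) (e * _) (e * _) (df * _) (df * _) (df * _).
    by clear; move=> *; lra.
have Gb : G b.
  have ne : [set c | G c] !=set0 by exists a.
  have ub : has_ubound [set c | G c] by exists b => c [].
  pose t := sup [set c | G c].
  have at' : a <= t by apply: ub_le_sup.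
  have tb : t <= b by apply: ge_sup => // c [].
  have [|dl dl0 Hs] := step t; first by rewrite at'.
  have [c Gc ct] := sup_adherent dl0 (conj ne ub).
  have ct' : c <= t by apply: ub_le_sup.
  have cd : `|c - t| < dl by rewrite ler0_norm ?subr_le0// /t; lra.
  (* This point is good, hence at most [t]; so the minimum is [b]. *)
  pose c' := Num.min b (t + dl / 2).
  have tc' : t <= c' by rewrite le_min tb; lra.
  have c'b : c' <= b by rewrite ge_min lexx.
  have c'd : `|c' - t| < dl.
    rewrite ger0_norm ?subr_ge0// ltrBlDr gt_min; apply/orP; right; lra.
  have Gc' := Hs c c' Gc ct' tc' c'b cd c'd.
  have : c' <= t by apply: ub_le_sup.
  rewrite /c' ge_min => /orP[bt|]; last by lra.
  by have -> : b = c' by rewrite /c' min_l//; lra.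
have [_ _ [s [s1 s2 s3 s4]]] := Gb.
have sd : \sum_(p <- s) (p.2 - p.1) < d.
  rewrite -lte_fin; apply: le_lt_trans mUd; apply: (le_trans s3).
  by apply: le_measure; rewrite ?inE//; exact: measurableI.
by apply: (le_trans s4); rewrite lerD2l ltW// Hd.
Qed.

End ac_monotone.

(** * Trajectories of the Loewner-Kufarev equation *)

Section trajectories.
Context {R : realType}.
Implicit Types (f w : R -> Cplx R) (a b s t e : R) (v c z : Cplx R).
Local Notation mu := (@lebesgue_measure R).

Definition tder f t v :=
  is_derive t 1 (fun s => ReC (f s)) (ReC v) /\
  is_derive t 1 (fun s => ImC (f s)) (ImC v).

Lemma has_time_derivative_tder f t v : has_time_derivative f t v -> tder f t v.
Proof.
move=> H.
have {}H e : 0 < e -> exists2 d, 0 < d & forall t', `|t' - t| < d ->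
    cmod (f t' - f t - v * ((t' - t)%:C)%C) <= e * `|t' - t|.
  move=> e0; move: H => /cvgrPdist_lt /(_ (e%:C)%C).
  rewrite ltcR => /(_ e0) [/= d d0 {}H]; exists d => // t' td.
  have [->|tt] := eqVneq t' t; first by rewrite !subrr mulr0 subr0 cmod0 normr0 mulr0.
  have := H (t' - t); rewrite /ball_ /= sub0r normrN subr_eq0 => /(_ td tt).
  rewrite subrKC normE ltcR => /ltW h.
  have n0 : ((t' - t)%:C)%C != 0 :> Cplx R.
    by rewrite -cmod_gt0 cmod_real normr_gt0 subr_eq0.
  rewrite -(cmod_real (t' - t)) -ler_pdivrMr ?cmod_gt0//.
  rewrite -Normc.normcV -cmodM; apply: le_trans h.
  by rewrite cmodB le_eqVlt; apply/orP; left; apply/eqP; congr cmod; rewrite mulrBl mulfK// mulrC.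
by split; apply: approx_is_derive => e /H[d d0 {}H]; exists d => // t' /H;
  apply: le_trans; [have := normr_Re (f t' - f t - v * ((t' - t)%:C)%C)
                   |have := normr_Im (f t' - f t - v * ((t' - t)%:C)%C)];
  rewrite !ReImE /= mulr0 ?subr0 ?add0r.
Qed.

Lemma tderB f g t v v' : tder f t v -> tder g t v' ->
  tder (fun s => f s - g s) t (v - v').
Proof.
move=> [f1 f2] [g1 g2]; split; rewrite !ReImE.
  rewrite (_ : (fun s => _) = (fun s => ReC (f s)) - (fun s => ReC (g s))).
    exact: is_deriveB.
  by apply/funext => s; rewrite !ReImE.
rewrite (_ : (fun s => _) = (fun s => ImC (f s)) - (fun s => ImC (g s))).
  exact: is_deriveB.
by apply/funext => s; rewrite !ReImE.
Qed.

Lemma tder_sqr f t v : tder f t v ->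
  is_derive t 1 (fun s => cmod (f s) ^+ 2)
    (2 * (ReC (f t) * ReC v + ImC (f t) * ImC v)).
Proof.
move=> [f1 f2].
have := is_deriveD (is_deriveM f1 f1) (is_deriveM f2 f2).
rewrite (_ : _ + _ = fun s => cmod (f s) ^+ 2).
  by move=> /is_derive_eq; apply; rewrite /GRing.scale /=; ring.
by apply/funext => s; rewrite sqr_cmod !expr2.
Qed.

Lemma tder_dot f t v c : tder f t v ->
  is_derive t 1 (fun s => ReC (c * f s)) (ReC (c * v)).
Proof.
move=> [f1 f2].
have := is_deriveB (is_deriveM (is_derive_cst (ReC c) t 1) f1)
  (is_deriveM (is_derive_cst (ImC c) t 1) f2).
rewrite (_ : _ - _ = fun s => ReC (c * f s)).
  by move=> /is_derive_eq; apply; rewrite !ReImE /GRing.scale /=; ring.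
by apply/funext => s; rewrite !ReImE.
Qed.

Lemma sqr_cmodB_le (x y : Cplx R) (M : R) : cmod x <= M -> cmod y <= M ->
  `|cmod y ^+ 2 - cmod x ^+ 2| <= 2 * M * cmod (y - x).
Proof.
move=> xM yM; rewrite subr_sqr normrM mulrC ler_pM ?normr_ge0//.
  by rewrite ger0_norm ?addr_ge0 ?cmod_ge0//; lra.
have := cmodD (y - x) x; have := cmodD (x - y) y; rewrite !subrK (cmodB x y).
by rewrite ler_norml => *; apply/andP; split; lra.
Qed.

Lemma Re_conj_mul (x y : Cplx R) : `|ReC x * ReC y + ImC x * ImC y| <= cmod x * cmod y.
Proof.
have := normr_Re ((ReC x -i* ImC x)%C * y).
rewrite cmodM Re_mul /= mulNr opprK => /le_trans; apply.
by rewrite ler_wpM2r ?cmod_ge0// !cmodE /= sqrrN.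
Qed.

End trajectories.

(** * Monotone modulus and backward stability *)

Section loewner_trajectories.
Context {R : realType}.
Variable p : Cplx R -> R -> Cplx R.
Hypothesis p_class : forall t : R, 0 <= t -> class_P (fun z => p z t).
Implicit Types (u : R -> Cplx R) (a b s t e : R) (c z : Cplx R).
Local Notation mu := (@lebesgue_measure R).

Lemma ae_lebesgue_filter : Filter (almost_everywhere mu).
Proof. exact: ae_filter_ringOfSetsType. Qed.

Definition trajectory u :=
  [/\ forall t, 0 <= t -> unit_disc (u t), locally_absolutely_continuous u &
      {ae mu, forall t : R, 0 <= t ->
        has_time_derivative u t (- u t * p (u t) t)}].

(** Half the rate of change of |z|^2 along the field [- z * q]. *)
Lemma Re_field_dot (z q : Cplx R) :
  ReC z * ReC (- z * q) + ImC z * ImC (- z * q) = - (cmod z ^+ 2 * ReC q).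
Proof. by rewrite sqr_cmod !ReImE; ring. Qed.

Lemma trajectory_cmod u s t : trajectory u -> 0 <= s -> s <= t ->
  cmod (u t) ^+ 2 <= cmod (u s) ^+ 2.
Proof.
move=> [uD uac uder] s0 st.
have uac' := uac s t s0 st.
suff : - cmod (u s) ^+ 2 <= - cmod (u t) ^+ 2 by rewrite lerN2.
apply: (@ac_nondecreasing _ (fun x => - cmod (u x) ^+ 2) s t st).
  apply: (@real_ac_dominated _ s t _ u u 2) => // x y sx xy yt.
  have xD : cmod (u x) <= 1 by rewrite ltW// uD// (le_trans s0).
  have yD : cmod (u y) <= 1 by rewrite ltW// uD// (le_trans s0)// (le_trans sx)// ltW.
  rewrite -opprD normrN (le_trans (sqr_cmodB_le xD yD))// mulr1 ler_pM2l//.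
  by rewrite -addrA lerDl addr_ge0 ?cmod_ge0// subr_ge0 ltW.
move: uder; apply: (@filterS _ _ ae_lebesgue_filter) => x H /andP[sx xt].
have x0 : 0 <= x by exact: le_trans sx.
have xd := is_deriveN (tder_sqr (has_time_derivative_tder (H x0))).
exists (2 * (cmod (u x) ^+ 2 * ReC (p (u x) x))).
  by move: xd => /is_derive_eq; apply; rewrite Re_field_dot; ring.
have [_ _ pp] := p_class x0.
by rewrite mulr_ge0// mulr_ge0 ?sqr_ge0// ltW// pp//; exact: uD.
Qed.

(** Gronwall's inequality read backwards: two solutions approach each other at most at the
    exponential rate set by the Lipschitz constant, so multiplying by [expR (L * x)] makes the
    squared distance nondecreasing. [L] is twice that constant because the distance is squared. *)
Lemma trajectory_backward (rho : R) : 0 <= rho -> rho < 1 ->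
  exists2 L, 0 <= L & forall u1 u2 s t, trajectory u1 -> trajectory u2 ->
    0 <= s -> s <= t ->
    (forall x, s <= x <= t -> cmod (u1 x) <= rho /\ cmod (u2 x) <= rho) ->
    expR (L * s) * cmod (u1 s - u2 s) ^+ 2 <=
    expR (L * t) * cmod (u1 t - u2 t) ^+ 2.
Proof.
move=> rho0 rho1; have [L0 L00 HL] := @class_P_lipschitz R rho rho0 rho1.
pose L : R := 2 * L0; have L_ge0 : 0 <= L by rewrite mulr_ge0.
exists L => // u1 u2 s t [uD1 uac1 uder1] [uD2 uac2 uder2] s0 st urho.
have expL (x : R) : is_derive x 1 (fun x : R => expR (L * x)) (expR (L * x) * L).
  have d1 : is_derive x 1 (fun x : R => L * x) L.
    by have := is_deriveZ L (is_derive_id x (1 : R)) => /is_derive_eq; apply; rewrite /GRing.scale /= mulr1.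
  by have := is_derive1_comp (is_derive_expR (L * x)) d1.
pose M : R := expR (L * t); have M0 : 0 <= M by exact: expR_ge0.
have ML : 0 <= M * L by rewrite mulr_ge0.
have expM x : x <= t -> expR (L * x) <= M by move=> xt; rewrite ler_expR ler_wpM2l.
have explip (x y : R) : x < y -> y <= t -> `|expR (L * y) - expR (L * x)| <= M * L * (y - x).
  move=> xy yt.
  have [|k kxy ->] := MVT xy (fun k _ => expL k).
    by apply: derivable_within_continuous => k _; have [] := expL k.
  move: kxy; rewrite in_itv /= => /andP[xk ky].
  rewrite normrM (ger0_norm (_ : 0 <= y - x)) ?subr_ge0 ?(ltW xy)//.
  rewrite ler_wpM2r ?subr_ge0 ?(ltW xy)// ger0_norm ?mulr_ge0 ?expR_ge0//.
  by rewrite ler_wpM2r// expM// (le_trans (ltW ky)).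
apply: (@ac_nondecreasing _ (fun x => expR (L * x) * cmod (u1 x - u2 x) ^+ 2) s t st).
  apply: (@real_ac_dominated _ s t _ u1 u2 (4 * (M * L) + 4 * M)).
  - by rewrite addr_ge0// mulr_ge0.
  - exact: uac1.
  - exact: uac2.
  move=> x y sx xy yt.
  have le2 k : s <= k <= t -> cmod (u1 k - u2 k) <= 2.
    move=> /andP[sk kt]; have k0 : 0 <= k by exact: le_trans sk.
    rewrite (le_trans (cmodD _ _))// normcN.
    by have := uD1 k k0; have := uD2 k k0; rewrite /unit_disc /=; lra.
  have x2 : cmod (u1 x - u2 x) <= 2 by apply: le2; lra.
  have y2 : cmod (u1 y - u2 y) <= 2 by apply: le2; lra.
  have sq := sqr_cmodB_le x2 y2.
  have Dl : cmod (u1 y - u2 y - (u1 x - u2 x)) <= cmod (u1 y - u1 x) + cmod (u2 y - u2 x).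
    rewrite (_ : _ - _ = (u1 y - u1 x) - (u2 y - u2 x)); last by ring.
    by rewrite (le_trans (cmodD _ _))// normcN.
  rewrite (_ : _ - _ = (expR (L * y) - expR (L * x)) * cmod (u1 y - u2 y) ^+ 2 +
     expR (L * x) * (cmod (u1 y - u2 y) ^+ 2 - cmod (u1 x - u2 x) ^+ 2)); last by ring.
  have t1 : `|(expR (L * y) - expR (L * x)) * cmod (u1 y - u2 y) ^+ 2| <=
     (M * L) * (y - x) * 4.
    rewrite normrM ler_pM// ?explip// ger0_norm ?sqr_ge0//.
    by rewrite (_ : 4 = 2 ^+ 2) ?ler_sqr ?nnegrE ?cmod_ge0//; ring.
  have t2 : `|expR (L * x) * (cmod (u1 y - u2 y) ^+ 2 - cmod (u1 x - u2 x) ^+ 2)| <=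
     M * (4 * (cmod (u1 y - u1 x) + cmod (u2 y - u2 x))).
    rewrite normrM ler_pM//.
      by rewrite ger0_norm ?expR_ge0// expM// (le_trans (ltW xy)).
    apply: (le_trans sq); rewrite (_ : 2 * 2 = 4 :> R); last by ring.
    by rewrite ler_wpM2l.
  apply: (le_trans (ler_normD _ _)); apply: (le_trans (lerD t1 t2)).
  have c1 := cmod_ge0 (u1 y - u1 x); have c2 := cmod_ge0 (u2 y - u2 x).
  move: (cmod (u1 y - u1 x)) (cmod (u2 y - u2 x)) c1 c2 => k1 k2 k10 k20.
  have yx : 0 <= y - x by rewrite subr_ge0 ltW.
  have := mulr_ge0 ML (addr_ge0 k10 k20); have := mulr_ge0 M0 yx.
  by generalize (M * L) M (y - x) => ML' M' l; clear; lra.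
move: uder1 uder2; apply: (@filterS2 _ _ ae_lebesgue_filter) => x H1 H2 /andP[sx xt].
have x0 : 0 <= x by exact: le_trans sx.
have [r1 r2] : cmod (u1 x) <= rho /\ cmod (u2 x) <= rho by apply: urho; rewrite sx xt.
have := tderB (has_time_derivative_tder (H1 x0)) (has_time_derivative_tder (H2 x0)).
set V := _ - _ => /tder_sqr dsq.
have := is_deriveM (expL x) dsq.
set dd := (X in is_derive _ _ _ X) => Hdd.
exists dd; first exact: Hdd.
rewrite /dd /GRing.scale /=.
have := Re_conj_mul (u1 x - u2 x) V.
have : cmod V <= L0 * cmod (u1 x - u2 x).
  have := HL _ (u1 x) (u2 x) (p_class x0) r1 r2.
  by rewrite /V -normcN; congr (cmod _ <= _); ring.
move: (cmod (u1 x - u2 x)) (cmod_ge0 (u1 x - u2 x)) (ReC _ * _ + _) => k k0 dot h1 h2.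
rewrite (_ : _ + _ = expR (L * x) * (2 * (L0 * k ^+ 2 + dot))); last by rewrite /L; ring.
rewrite mulr_ge0 ?expR_ge0// mulr_ge0//.
have : k * cmod V <= k * (L0 * k) by rewrite ler_wpM2l.
by move: h2; rewrite ler_norml => /andP[+ _]; rewrite expr2; lra.
Qed.

End loewner_trajectories.

(** * Length of a trajectory near the unit circle *)

Section arc_length.
Context {R : realType}.
Variables (p : Cplx R -> R -> Cplx R) (alpha C1 : R).
Hypothesis p_class : forall t : R, 0 <= t -> class_P (fun z => p z t).
Hypotheses (alpha_gt0 : 0 < alpha) (alpha_lt1 : alpha < 1) (C1_gt0 : 0 < C1).
Hypothesis p_ratio : forall z (t : R), unit_disc z -> 0 <= t ->
  cmod (p z t) / ReC (p z t) <= C1 / (1 - cmod z) `^ alpha.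
Implicit Types (u : R -> Cplx R) (t : R) (c v z : Cplx R).

(** The derivative (1 - alpha) k^(- alpha) decreases in k, so its value at [m] bounds it. It is
    unbounded near 0, whence the lower bound [m]. *)
Lemma powR_lipschitz (m x y : R) : 0 < m -> m <= x -> m <= y ->
  `|y `^ (1 - alpha) - x `^ (1 - alpha)| <= (1 - alpha) / m `^ alpha * `|y - x|.
Proof.
move=> m0; wlog xy : x y / x <= y.
  move=> H mx my; have [/H|/ltW/H] := leP x y; first exact.
  by rewrite distrC (distrC y); apply.
move=> mx my; have x0 := lt_le_trans m0 mx.
have ab : 0 <= 1 - alpha by rewrite subr_ge0 ltW.
have dp (k : R) : x <= k -> is_derive k 1 (@powR R ^~ (1 - alpha))
    ((1 - alpha) * k `^ (1 - alpha - 1)).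
  by move=> xk; apply: is_derive1_powR; exact: lt_le_trans xk.
have [||k] := @MVT_segment _ (@powR R ^~ (1 - alpha))
  (fun k => (1 - alpha) * k `^ (1 - alpha - 1)) x y xy.
- by move=> k; rewrite in_itv /= => /andP[/ltW xk _]; exact: dp.
- by apply: derivable_within_continuous => k; rewrite in_itv /= => /andP[/dp[]].
rewrite in_itv /= => /andP[xk ky] ->.
rewrite normrM ler_wpM2r// (_ : 1 - alpha - 1 = - alpha); last by ring.
rewrite powRN ger0_norm ?mulr_ge0 ?invr_ge0 ?powR_ge0//.
rewrite ler_wpM2l// lef_pV2 ?posrE ?powR_gt0//; last by rewrite (lt_le_trans x0).
by apply: ge0_ler_powR; rewrite ?nnegrE ?(ltW alpha_gt0) ?(ltW m0)//; lra.
Qed.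

(** With r = |z|, the 4 combines r <= 2 r^2, valid for r >= 1/2, with (1 - r^2)^alpha <= 2 (1 -
    r)^alpha, which follows from 1 - r^2 <= 2 (1 - r) and 2^alpha <= 2. *)
Lemma speed_bound z t : 0 <= t -> unit_disc z -> 1 / 2 <= cmod z ->
  cmod z * cmod (p z t) <= 4 * C1 * cmod z ^+ 2 * ReC (p z t) * (1 - cmod z ^+ 2) `^ (- alpha).
Proof.
move=> t0 zD z2; have [_ _ /(_ z zD) pp] := p_class t0.
have := p_ratio zD t0; move: zD; rewrite /unit_disc /=.
move: (cmod z) (cmod_ge0 z) z2 => r r0 r2 r1.
rewrite ler_pdivrMr//; move: (cmod (p z t)) (ReC (p z t)) pp => q P P0 qP.
have B0 : 0 < (1 - r) `^ alpha by rewrite powR_gt0// subr_gt0.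
have r21 : r ^+ 2 < 1 by rewrite expr_lt1.
have A0 : 0 < (1 - r ^+ 2) `^ alpha by rewrite powR_gt0// subr_gt0.
have AB : (1 - r ^+ 2) `^ alpha <= 2 * (1 - r) `^ alpha.
  apply: (@le_trans _ _ ((2 * (1 - r)) `^ alpha)).
    apply: ge0_ler_powR; rewrite ?nnegrE ?(ltW alpha_gt0) ?subr_ge0 ?(ltW r21)//.
      by rewrite mulr_ge0// subr_ge0 ltW.
    by have := sqr_ge0 (1 - r); rewrite (_ : (1 - r) ^+ 2 = 1 - 2 * r + r ^+ 2); [lra|ring].
  rewrite powRM ?subr_ge0 ?(ltW r1)// ler_wpM2r ?(ltW B0)//.
  by rewrite -[leRHS](@powRr1 R 2)// ler_powR ?ler1n// ltW.
have iAB : ((1 - r) `^ alpha)^-1 <= 2 * ((1 - r ^+ 2) `^ alpha)^-1.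
  by rewrite ler_pdivlMr// mulrC ler_pdivrMr.
rewrite powRN; move: iAB qP (invr_ge0 ((1 - r ^+ 2) `^ alpha)); rewrite (ltW A0).
move: (((1 - r) `^ alpha)^-1) (((1 - r ^+ 2) `^ alpha)^-1) => iB iA iAB qP iA0.
have X0 : 0 <= C1 * (2 * iA) * P by rewrite !mulr_ge0// ltW.
have h1 : r * q <= r * (C1 * (2 * iA) * P).
  rewrite ler_wpM2l// (le_trans qP)// ler_wpM2r ?(ltW P0)//.
  by rewrite ler_wpM2l// ltW.
apply: (le_trans h1).
rewrite (_ : 4 * _ * _ * _ * _ = (2 * r ^+ 2) * (C1 * (2 * iA) * P)); last by ring.
rewrite ler_wpM2r// expr2 mulrA ler_peMl//; lra.
Qed.

Lemma is_derive_excess u (x K beta : R) c v : tder u x v -> 0 < 1 - cmod (u x) ^+ 2 ->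
  is_derive x 1 (fun x => K * (1 - cmod (u x) ^+ 2) `^ beta - ReC (c * u x))
    (K * (beta * (1 - cmod (u x) ^+ 2) `^ (beta - 1) *
      - (2 * (ReC (u x) * ReC v + ImC (u x) * ImC v))) - ReC (c * v)).
Proof.
move=> xd qlt.
have d1 : is_derive x 1 (fun x => 1 - cmod (u x) ^+ 2)
    (- (2 * (ReC (u x) * ReC v + ImC (u x) * ImC v))).
  have := is_deriveB (is_derive_cst (1 : R) x (1 : R)) (tder_sqr xd).
  by move=> /is_derive_eq; apply; rewrite sub0r.
have d2 := @is_derive1_comp R (@powR R ^~ beta) (fun x => 1 - cmod (u x) ^+ 2) x _ _
  (is_derive1_powR beta qlt) d1.
exact: (is_deriveB (is_deriveZ K d2) (tder_dot c xd)).
Qed.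

(* The left side of [speed_bound] is |u'|, and its right side is the derivative of
   K (1 - |u|^2)^(1 - alpha) with K = 2 C1 / (1 - alpha). *)
Lemma trajectory_arc u t : trajectory p u -> 0 <= t -> 1 / 4 <= cmod (u t) ^+ 2 ->
  cmod (u t - u 0) <= 2 * C1 / (1 - alpha) * (1 - cmod (u t) ^+ 2) `^ (1 - alpha).
Proof.
move=> tu t0 ut4; have [uD uac uder] := tu.
have ab : 0 < 1 - alpha by rewrite subr_gt0.
set K := 2 * C1 / (1 - alpha).
have K0 : 0 <= K by rewrite divr_ge0 ?mulr_ge0// ltW.
apply: cmod_dual => c c1.
pose q x := cmod (u x) ^+ 2.
(* Since |u| is nonincreasing, 1 - |u|^2 never drops below [m], which keeps the power Lipschitz
   along the trajectory. *)
pose m := 1 - q 0.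
have m0 : 0 < m.
  by rewrite subr_gt0 expr_lt1// ?cmod_ge0//; exact: (uD 0 (lexx 0)).
have mq x : 0 <= x -> m <= 1 - q x.
  by move=> x0; rewrite lerB//; exact: (trajectory_cmod p_class tu).
suff : K * (1 - q 0) `^ (1 - alpha) - ReC (c * u 0) <=
       K * (1 - q t) `^ (1 - alpha) - ReC (c * u t).
  have : 0 <= K * (1 - q 0) `^ (1 - alpha) by rewrite mulr_ge0// powR_ge0.
  by rewrite mulrBr Re_add Re_opp /q; lra.
pose M := K * ((1 - alpha) / m `^ alpha).
have M0 : 0 <= M by rewrite mulr_ge0// divr_ge0 ?powR_ge0// ltW.
have xp1 (x : R) : 0 <= x -> cmod (u x) <= 1 by move=> /uD/ltW.
apply: (@ac_nondecreasing _ (fun x => K * (1 - q x) `^ (1 - alpha) - ReC (c * u x)) 0 t t0).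
  apply: (@real_ac_dominated _ 0 t _ u u (2 * M + 1)).
  - by rewrite addr_ge0// mulr_ge0.
  - exact: uac.
  - exact: uac.
  move=> x y x0 xy yt; have y0 : 0 <= y by rewrite (le_trans x0)// ltW.
  rewrite (_ : _ - _ = K * ((1 - q y) `^ (1 - alpha) - (1 - q x) `^ (1 - alpha))
     - ReC (c * (u y - u x))); last by rewrite (mulrBr c) Re_add Re_opp; ring.
  have h1 := powR_lipschitz m0 (mq _ x0) (mq _ y0).
  have h2 := sqr_cmodB_le (xp1 _ x0) (xp1 _ y0).
  have h3 : `|ReC (c * (u y - u x))| <= cmod (u y - u x).
    by rewrite (le_trans (normr_Re _))// cmodM ler_piMl// cmod_ge0.
  have h4 : `|K * ((1 - q y) `^ (1 - alpha) - (1 - q x) `^ (1 - alpha))| <=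
     M * (2 * cmod (u y - u x)).
    rewrite normrM (ger0_norm K0) /M -mulrA ler_wpM2l//; apply: (le_trans h1).
    rewrite ler_wpM2l ?divr_ge0 ?powR_ge0 ?(ltW ab)//.
    rewrite (_ : 1 - q y - (1 - q x) = - (q y - q x)); last by ring.
    by rewrite normrN; move: h2; rewrite mulr1.
  apply: (le_trans (ler_normB _ _)).
  have k0 := cmod_ge0 (u y - u x).
  apply: (le_trans (lerD h4 h3)).
  have yx : 0 <= y - x by rewrite subr_ge0 ltW.
  move: (cmod (u y - u x)) k0 => k k0.
  have := mulr_ge0 M0 k0; have := mulr_ge0 M0 yx.
  by generalize M => M'; move: k0 yx; lra.
move: uder; apply: (@filterS _ _ ae_lebesgue_filter) => x H /andP[x0 xt].
have xd := has_time_derivative_tder (H x0).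
have qlt : 0 < 1 - q x by apply: lt_le_trans (mq _ x0).
have d3 := is_derive_excess K (1 - alpha) c xd qlt.
set dd := (X in is_derive _ _ _ X) in d3.
exists dd; first exact: d3.
rewrite /dd Re_field_dot.
have -> : 1 - alpha - 1 = - alpha by ring.
rewrite subr_ge0.
(* The bound assumed at the final time holds at earlier times too, where the modulus is at least as
   large. *)
have ux2 : 1 / 2 <= cmod (u x).
  rewrite -(@ler_sqr R) ?nnegrE ?cmod_ge0 ?divr_ge0//.
  by rewrite (le_trans _ (trajectory_cmod p_class tu x0 xt))// (le_trans _ ut4)//; lra.
have sb := speed_bound x0 (uD _ x0) ux2.
rewrite (le_trans (ler_norm _))// (le_trans (normr_Re _))// cmodM.
rewrite (@le_trans _ _ (1 * cmod (- u x * p (u x) x)))//.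
  by rewrite ler_wpM2r ?cmod_ge0.
rewrite mul1r cmodM normcN (le_trans sb)//.
rewrite le_eqVlt; apply/orP; left; apply/eqP.
by rewrite /K /q; field; rewrite gt_eqF.
Qed.

End arc_length.

(** * Uniform continuity of the inverse *)

Section inverse_modulus.
Context {R : realType}.
Variables (p : Cplx R -> R -> Cplx R) (alpha C1 : R).
Hypothesis p_class : forall t : R, 0 <= t -> class_P (fun z => p z t).
Hypotheses (alpha_gt0 : 0 < alpha) (alpha_lt1 : alpha < 1) (C1_gt0 : 0 < C1).
Hypothesis p_ratio : forall z (t : R), unit_disc z -> 0 <= t ->
  cmod (p z t) / ReC (p z t) <= C1 / (1 - cmod z) `^ alpha.
Implicit Types (u : R -> Cplx R) (s t : R).

Lemma absolutely_continuous_step (a b : R) (f : R -> Cplx R) (e : R) :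
  absolutely_continuous a b f -> 0 < e -> exists2 d, 0 < d &
  forall x y : R, a <= x -> x < y -> y <= b -> y - x < d -> cmod (f y - f x) < e.
Proof.
move=> H /H[d d0 {}H]; exists d => // x y ax xy yb yxd.
have := H 1%N (fun=> x) (fun=> y); rewrite !big_ord1; apply => //.
by apply/trivIsetP => i j _ _; rewrite !ord1 eqxx.
Qed.

Lemma within_continuous_segment (f : R -> R) (a b : R) :
  (forall e, 0 < e -> exists2 d, 0 < d & forall x y : R, a <= x -> x < y -> y <= b ->
    y - x < d -> `|f y - f x| < e) ->
  {within `[a, b], continuous f}.
Proof.
move=> H; apply/subspace_continuousP => x; rewrite /= in_itv /= => /andP[ax xb].
apply/cvgrPdist_lt => e e0; have [d d0 {}H] := H e e0.
rewrite near_withinE; near=> y; rewrite /= in_itv /= => /andP[ay yb].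
have : `|x - y| < d by near: y; apply: cvgr_dist_lt => //; exact: cvg_id.
rewrite /from_subspace; have [->|xy] := eqVneq x y; first by move=> _; rewrite subrr normr0.
rewrite ltr_norml => /andP[d1 d2].
move: xy; rewrite neq_lt => /orP[xy|yx]; last by apply: H => //; lra.
by rewrite distrC; apply: H => //; lra.
Unshelve. all: by end_near. Qed.

(* [s] is the last time at which |u|^2 >= k, or 0 if there is none. *)
Lemma trajectory_crossing u t (k : R) : trajectory p u -> 0 <= t ->
  exists s, [/\ 0 <= s, s <= t,
    s = t \/ (forall x, s <= x <= t -> cmod (u x) ^+ 2 <= k) &
    s = 0 \/ k <= cmod (u s) ^+ 2].
Proof.
move=> tu t0; have [uD uac _] := tu.
have mono s x : 0 <= s -> s <= x -> cmod (u x) ^+ 2 <= cmod (u s) ^+ 2.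
  exact: (trajectory_cmod p_class tu).
have [kt|tk] := leP k (cmod (u t) ^+ 2).
  by exists t; split => //; [left|right].
have [k0|k0] := leP (cmod (u 0) ^+ 2) k.
  exists 0; split => //; [right|by left] => x /andP[x0 xt].
  by apply: le_trans k0; exact: mono.
have qc : {within `[0, t], continuous (fun x => cmod (u x) ^+ 2)}.
  apply: within_continuous_segment => e e0.
  have e2 : 0 < e / 2 by rewrite divr_gt0.
  have [d d0 H] := absolutely_continuous_step (uac 0 t (lexx 0) t0) e2.
  exists d => // x y x0 xy yt yxd.
  have xp1 (v : R) : 0 <= v -> cmod (u v) <= 1 by move=> /uD/ltW.
  have y0 : 0 <= y by rewrite (le_trans x0)// ltW.
  apply: (le_lt_trans (sqr_cmodB_le (xp1 _ x0) (xp1 _ y0))).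
  have := H x y x0 xy yt yxd; lra.
have [|s] := @IVT _ (fun x => cmod (u x) ^+ 2) 0 t k t0 qc.
  by rewrite ge_min le_max (ltW tk) (ltW k0) orbT.
rewrite in_itv /= => /andP[s0 st] qs.
exists s; split => //; right; last by rewrite qs.
by move=> x /andP[sx xt]; rewrite -qs; apply: mono.
Qed.

Lemma inverse_modulus t (e : R) : 0 <= t -> 0 < e -> exists2 d, 0 < d &
  forall u1 u2, trajectory p u1 -> trajectory p u2 ->
    cmod (u1 t - u2 t) < d -> cmod (u1 0 - u2 0) <= e.
Proof.
move=> t0 e0.
have b0 : 0 < 1 - alpha by rewrite subr_gt0.
pose K := 2 * C1 / (1 - alpha).
have K0 : 0 < K by rewrite divr_gt0 ?mulr_gt0.
(* At time [s] one trajectory satisfies |u|^2 >= 1 - del and the other is only known to satisfy it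
   with [2 * del], hence the factor 2. The bound 1/4 ensures 1 - 2 del >= 1/4, as [trajectory_arc]
   demands. *)
have [del [del0 del4 Hdel]] : exists del : R,
    [/\ 0 < del, del <= 1 / 4 & K * (2 * del) `^ (1 - alpha) <= e / 4].
  have eK : 0 < e / (4 * K) by rewrite divr_gt0// mulr_gt0.
  pose m := Num.min (1 / 2) ((e / (4 * K)) `^ (1 - alpha)^-1).
  have m0 : 0 < m by rewrite lt_min divr_gt0//= powR_gt0.
  have m2 : m <= 1 / 2 by rewrite ge_min lexx.
  exists (m / 2); split; [by rewrite divr_gt0|lra|].
  rewrite (_ : 2 * (m / 2) = m); last by field.
  have : m `^ (1 - alpha) <= ((e / (4 * K)) `^ (1 - alpha)^-1) `^ (1 - alpha).
    apply: ge0_ler_powR; rewrite ?nnegrE ?powR_ge0 ?(ltW b0) ?(ltW m0)//.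
    by rewrite ge_min lexx orbT.
  rewrite -powRrM mulVf ?gt_eqF// powRr1 ?(ltW eK)// -(ler_pM2l K0) => /le_trans; apply.
  by rewrite le_eqVlt; apply/orP; left; apply/eqP; field; rewrite gt_eqF.
pose rho := Num.sqrt (1 - del).
have d1 : 0 <= 1 - del by lra.
have rho0 : 0 <= rho by exact: sqrtr_ge0.
have rhoE : rho ^+ 2 = 1 - del by rewrite sqr_sqrtr.
have rho1 : rho < 1 by rewrite -(@expr_lt1 _ 2)// rhoE; lra.
have [L L0 HL] := trajectory_backward p_class rho0 rho1.
pose k := expR (L * t); have k1 : 1 <= k by rewrite -expR0 ler_expR mulr_ge0.
have k0 : 0 < k by exact: expR_gt0.
(* A distance of [del / 2] changes the squared modulus by at most [del]; [e / 2] is what remains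
   after two arcs of length at most [e / 4]. *)
pose eta := Num.min (del / 2) (e / 2).
have eta0 : 0 < eta by rewrite lt_min !divr_gt0.
have eta_del : eta <= del / 2 by rewrite ge_min lexx.
have eta_e : eta <= e / 2 by rewrite ge_min lexx orbT.
clearbody eta rho; rewrite -/K in Hdel.
(* The backward estimate concerns squares: [k * (eta / k) ^+ 2] is at most [eta ^+ 2] because
   [k >= 1]. *)
exists (eta / k); first by rewrite divr_gt0.
move=> u1 u2 tu1 tu2 dist.
have [s1 [s10 s1t far1 near1]] := trajectory_crossing (1 - del) tu1 t0.
have [s2 [s20 s2t far2 near2]] := trajectory_crossing (1 - del) tu2 t0.
(* After the later crossing both trajectories are in the smaller disc. At time [s] itself, either
   [s = 0] and the comparison is complete, or one of them is still in the shell and the other is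
   close to it. *)
pose s := Num.max s1 s2.
have s0 : 0 <= s by rewrite le_max s10.
have st : s <= t by rewrite ge_max s1t.
have le1 : s1 <= s by rewrite le_max lexx.
have le2 : s2 <= s by rewrite le_max lexx orbT.
have dist_eta : cmod (u1 t - u2 t) <= eta.
  by rewrite (le_trans (ltW dist))// ler_pdivrMr// ler_peMr// ltW.
have Ds : cmod (u1 s - u2 s) <= eta.
  have [->//|nst] := eqVneq s t.
  have stlt : s < t by rewrite lt_neqAle nst.
  have {}far1 : forall x, s1 <= x <= t -> cmod (u1 x) ^+ 2 <= 1 - del.
    by case: far1 => // E; move: (le_lt_trans le1 stlt); rewrite E ltxx.
  have {}far2 : forall x, s2 <= x <= t -> cmod (u2 x) ^+ 2 <= 1 - del.
    by case: far2 => // E; move: (le_lt_trans le2 stlt); rewrite E ltxx.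
  have inrho x : s <= x <= t -> cmod (u1 x) <= rho /\ cmod (u2 x) <= rho.
    move=> /andP[sx xt]; rewrite -!(@ler_sqr R _ rho) ?nnegrE ?cmod_ge0// rhoE.
    by split; [apply: far1|apply: far2]; rewrite xt andbT; apply: le_trans sx.
  have := HL u1 u2 s t tu1 tu2 s0 st inrho; rewrite -/k.
  have : 1 <= expR (L * s) by rewrite -expR0 ler_expR mulr_ge0.
  move=> E1 back.
  rewrite -(@ler_sqr R) ?nnegrE ?cmod_ge0// ?(ltW eta0)//.
  apply: (@le_trans _ _ (expR (L * s) * cmod (u1 s - u2 s) ^+ 2)).
    by rewrite ler_peMl// sqr_ge0.
  apply: (le_trans back).
  have : cmod (u1 t - u2 t) ^+ 2 <= (eta / k) ^+ 2.
    by rewrite ler_sqr ?nnegrE ?cmod_ge0 ?divr_ge0 ?(ltW eta0) ?(ltW k0)// ltW.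
  rewrite -(ler_pM2l k0) => /le_trans; apply.
  rewrite (_ : k * _ = eta ^+ 2 / k); last by field; rewrite gt_eqF.
  by rewrite ler_pdivrMr// ler_peMr// sqr_ge0.
have [[] | ] : (s = 0) \/ (1 - del <= cmod (u1 s) ^+ 2 \/ 1 - del <= cmod (u2 s) ^+ 2).
- rewrite /s /Num.max; case: ifP => _.
    by case: near2; [left|right; right].
  by case: near1; [left|right; left].
- by move=> s00; rewrite s00 in Ds; rewrite (le_trans Ds)// (le_trans eta_e)//; lra.
move=> big.
have disc (u : R -> Cplx R) : trajectory p u -> cmod (u s) <= 1.
  by move=> [/(_ s s0)/ltW].
have qdiff : `|cmod (u2 s) ^+ 2 - cmod (u1 s) ^+ 2| <= del.
  apply: (le_trans (sqr_cmodB_le (disc _ tu1) (disc _ tu2))).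
  by rewrite cmodB; lra.
have [q1 q2] : 1 - 2 * del <= cmod (u1 s) ^+ 2 /\ 1 - 2 * del <= cmod (u2 s) ^+ 2.
  by move: qdiff; rewrite ler_norml => /andP[? ?]; case: big => ?; split; lra.
have arc u : trajectory p u -> 1 - 2 * del <= cmod (u s) ^+ 2 ->
    cmod (u s - u 0) <= e / 4.
  move=> tu q.
  have q4 : 1 / 4 <= cmod (u s) ^+ 2 by lra.
  have := trajectory_arc p_class alpha_gt0 alpha_lt1 C1_gt0 p_ratio tu s0 q4.
  move=> /le_trans; apply; apply: le_trans Hdel; rewrite ler_wpM2l ?(ltW K0)//.
  apply: ge0_ler_powR; rewrite ?nnegrE ?(ltW b0) ?mulr_ge0 ?(ltW del0)//; last lra.
  by rewrite subr_ge0 exprn_ile1// ?cmod_ge0// disc.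
have a1 := arc _ tu1 q1; have a2 := arc _ tu2 q2.
rewrite (_ : u1 0 - u2 0 = (u1 s - u2 s) - (u1 s - u1 0) + (u2 s - u2 0)); last by ring.
rewrite (le_trans (cmodD _ _))//.
have := cmodD (u1 s - u2 s) (- (u1 s - u1 0)); rewrite normcN.
by lra.
Qed.

End inverse_modulus.

(** * Extension of the inverse to the closure *)

Section inverse_extension.
Context {R : realType}.
Implicit Types (z x y : Cplx R) (d e r : R) (h : Cplx R -> R).

Lemma closure_image_near (D : set (Cplx R)) (W : Cplx R -> Cplx R) x d :
  closure (W @` D) x -> 0 < d -> exists2 z, D z & cmod (W z - x) < d.
Proof.
move=> clx d0; have : nbhs x [set y | cmod (y - x) < d].
  by apply/nearE_cmod; exists d.
by move=> /clx[_ [[z Dz <-] /= zx]]; exists z.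
Qed.

Lemma cvg_within_cmod (A : set (Cplx R)) (g : Cplx R -> Cplx R) x :
  (forall e, 0 < e -> exists2 d, 0 < d &
    forall y, A y -> cmod (y - x) < d -> cmod (g x - g y) <= e) ->
  g @ within A (nbhs x) --> g x.
Proof.
move=> H; apply/cvgrPdist_le => e; rewrite ltcE /= => /andP[/eqP ime e0].
have [d d0 {}H] := H _ e0; apply/nearE_cmod; exists d => // y yx Ay.
by rewrite normE lecE /= ime eqxx /= H.
Qed.

Variables (D : set (Cplx R)) (W : Cplx R -> Cplx R).
Hypothesis W_inv : forall e, 0 < e -> exists2 d, 0 < d &
  forall z z', D z -> D z' -> cmod (W z - W z') < d -> cmod (z - z') <= e.

(* The lower limit of [h z] as [W z] tends to [x]. *)
Definition fiber_liminf h x : R :=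
  sup [set r | exists2 d, 0 < d &
    forall z, D z -> cmod (W z - x) < d -> r <= h z].

(** By [W_inv], h varies by at most e over the points whose image is near x, so the set defining the
    lower limit contains [h z - e] and is bounded by [h z + e]. The upper bound needs points with
    image arbitrarily near x, which the closure provides. *)
Lemma fiber_liminf_near h : (forall z z', `|h z - h z'| <= cmod (z - z')) ->
  forall e, 0 < e -> exists2 d, 0 < d & forall x z,
    closure (W @` D) x -> D z -> cmod (W z - x) < d ->
    `|fiber_liminf h x - h z| <= e.
Proof.
move=> hlip e e0; have [d d0 H] := W_inv e0.
have d20 : 0 < d / 2 by rewrite divr_gt0.
exists (d / 2) => // x z clx Dz zx.
have close z' : D z' -> cmod (W z' - x) < d / 2 -> `|h z' - h z| <= e.
  move=> Dz' z'x; apply: le_trans (hlip _ _) _; apply: H => //.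
  have := cmodD (W z' - x) (x - W z); rewrite subrKA (cmodB x) => /le_lt_trans; apply.
  by rewrite [ltRHS](splitr d) ltrD.
have low : [set r | exists2 d, 0 < d &
    forall z, D z -> cmod (W z - x) < d -> r <= h z] (h z - e).
  exists (d / 2) => // z' Dz' /(close _ Dz'); rewrite ler_norml => /andP[+ _]; lra.
have up : ubound [set r | exists2 d, 0 < d &
    forall z, D z -> cmod (W z - x) < d -> r <= h z] (h z + e).
  move=> r [d' d'0 Hr].
  have m0 : 0 < Num.min d' (d / 2) by rewrite lt_min d'0.
  have [z' Dz'] := closure_image_near clx m0.
  rewrite lt_min => /andP[/(Hr _ Dz') rz' /(close _ Dz')].
  by rewrite ler_norml => /andP[_ ?]; lra.
rewrite ler_distl; apply/andP; split.
  by apply: ub_le_sup => //; exists (h z + e).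
by apply: ge_sup => //; exists (h z - e).
Qed.

(** A uniformly continuous map extends to the closure. Real and imaginary parts are extended
    separately because the lower limit needs an order; one estimate, [near_g], yields both the
    values on the image (at [x = W z]) and the continuity. *)
Lemma inverse_extension : exists g : Cplx R -> Cplx R,
  (forall z, D z -> g (W z) = z) /\ {within closure (W @` D), continuous g}.
Proof.
have Re_lip z z' : `|ReC z - ReC z'| <= cmod (z - z').
  by have := normr_Re (z - z'); rewrite Re_add Re_opp.
have Im_lip z z' : `|ImC z - ImC z'| <= cmod (z - z').
  by have := normr_Im (z - z'); rewrite Im_add Im_opp.
pose g x : Cplx R := (fiber_liminf (fun z => ReC z) x +i* fiber_liminf (fun z => ImC z) x)%C.
have near_g e : 0 < e -> exists2 d, 0 < d & forall x z,
    closure (W @` D) x -> D z -> cmod (W z - x) < d -> cmod (g x - z) <= e.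
  move=> e0; have e2 : 0 < e / 2 by rewrite divr_gt0.
  have [d1 d10 H1] := fiber_liminf_near Re_lip e2.
  have [d2 d20 H2] := fiber_liminf_near Im_lip e2.
  exists (Num.min d1 d2); first by rewrite lt_min d10.
  move=> x z clx Dz; rewrite lt_min => /andP[/(H1 _ _ clx Dz) h1 /(H2 _ _ clx Dz) h2].
  by rewrite (le_trans (cmod_leD _))// !ReImE /= [leRHS](splitr e) lerD.
exists g; split=> [z Dz|].
  apply/eqP; rewrite -subr_eq0 -cmod_eq0 eq_le cmod_ge0 andbT.
  apply/ler_addgt0Pr => e /near_g[d d0 H]; rewrite add0r; apply: H => //.
    by apply: subset_closure; exists z.
  by rewrite subrr cmod0.
apply/subspace_continuousP => x clx; apply: cvg_within_cmod => e e0.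
have e2 : 0 < e / 2 by rewrite divr_gt0.
have [d d0 H] := near_g _ e2; have d20 : 0 < d / 2 by rewrite divr_gt0.
exists (d / 2) => // y cly yx; have [z Dz zx] := closure_image_near clx d20.
have gx : cmod (g x - z) <= e / 2 by apply: H => //; lra.
have gy : cmod (z - g y) <= e / 2.
  rewrite cmodB; apply: H => //.
  have := cmodD (W z - x) (x - y); rewrite subrKA (cmodB x) => /le_lt_trans; apply.
  by rewrite [ltRHS](splitr d) ltrD.
by have := cmodD (g x - z) (z - g y); rewrite subrKA; lra.
Qed.

End inverse_extension.

Theorem theorem1 (R : realType) (p w : Cplx R -> R -> Cplx R)
    (alpha C1 C2 : R)
    (p_class : forall t : R, 0 <= t -> class_P (fun z => p z t))
    (p_meas : forall z, unit_disc z ->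
       lebesgue_measurable_cfun `[0, +oo[%classic (p z))
    (alpha_gt0 : 0 < alpha) (alpha_lt1 : alpha < 1)
    (C1_gt0 : 0 < C1) (C2_gt0 : 0 < C2)
    (p_ratio : forall z (t : R), unit_disc z -> 0 <= t ->
       cmod (p z t) / ReC (p z t) <= C1 / (1 - cmod z) `^ alpha)
    (p_lower : forall z (t : R), unit_disc z -> 0 <= t ->
       C2 * (1 - cmod z) `^ alpha <= ReC (p z t))
    (w_sol : loewner_kufarev_solution p w) :
  forall t : R, 0 <= t ->
    exists g : Cplx R -> Cplx R,
      (forall z, unit_disc z -> g (w z t) = z) /\
      {within closure ((fun z => w z t) @` @unit_disc R), continuous g}.

Proof.
move=> t t0; apply: inverse_extension => e e0.
have [d d0 H] := inverse_modulus p_class alpha_gt0 alpha_lt1 C1_gt0 p_ratio t0 e0.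
have traj z : unit_disc z -> trajectory p (w z) by move=> /w_sol[].
exists d => // z z' zD zD' /(H _ _ (traj z zD) (traj z' zD')).
by have [-> _ _ _] := w_sol _ zD; have [-> _ _ _] := w_sol _ zD'.
Qed.
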